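(* Let $L_1,\dots,L_M\in\mathbb{N}$ and $q_1,\dots,q_M\in\mathbb{R}[x]$ with $\deg q_j<2L_j$, $q_j(0)=0$, and let $P(x,y)=\prod_{j=1}^M(y+q_j(x)+ix^{2L_j})$, $A=\tfrac12(P+\bar P)$, $B=\tfrac1{2i}(P-\bar P)$. Let $t\in\mathbb{R}$ be proper and write $a_j(x;t)=-q_j(x)-x^{2L_j}\psi_j(x;t)$ for the branches from the proper factorization. Let $1\le\mathfrak{p}<\infty$. Then for $Q\in\mathbb{C}\{x,y\}$, $Q/P\in L^{\mathfrak{p}}_{loc}$ if and only if for each $j=1,\dots,M$, $$\mathrm{Ord}\bigl(Q(x,a_j(x;t))\bigr)\ge\sum_{i=1}^MO_{ij}-\left\lceil\frac{2L_j+1}{\mathfrak{p}}\right\rceil+1.$$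
   Context: $\bar P(x,y)=\overline{P(\bar x,\bar y)}$. $\mathbb{C}\{x,y\}$ are convergent power series at the origin, $\mathbb{R}\{x\}$ convergent real-coefficient series in $x$; a unit is a series nonvanishing at the origin; Ord is order of vanishing at $0$. $f\in L^{\mathfrak{p}}_{loc}$ means $f\in L^{\mathfrak{p}}(U)$ for some neighborhood $U$ of $(0,0)$ in $\mathbb{R}^2$. $O_{ij}=\min\{\mathrm{Ord}(q_j-q_i),2L_j,2L_i\}$. A real $t$ is called proper if there is a local factorization $A+tB=u(x,y;t)\prod_{j=1}^M(y+q_j(x)+x^{2L_j}\psi_j(x;t))$ with $u(\cdot,\cdot;t)$ a unit, $\psi_j(\cdot;t)\in\mathbb{R}\{x\}$, and $\mathrm{Ord}(q_j-q_i+x^{2L_j}\psi_j(x;t)-x^{2L_i}\psi_i(x;t))=O_{ij}$ for all $i\ne j$; all but finitely many real $t$ are proper. *)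

(* Defs.v *)
From HB Require Import structures.
From mathcomp Require Import all_boot all_order all_algebra.
From mathcomp Require Import all_classical all_reals all_analysis.
From mathcomp Require Import complex.

Set Implicit Arguments.
Unset Strict Implicit.
Unset Printing Implicit Defensive.

Import Order.TTheory GRing.Theory Num.Theory.
Import numFieldNormedType.Exports.
Local Open Scope ring_scope.

Section Defs.
Variable R : realType.
Local Notation C := (R[i]).

Definition cmod (z : C) : R := Num.sqrt (complex.Re z ^+ 2 + complex.Im z ^+ 2).

Definition RtoC (r : R) : C := Complex r 0.

Definition cconj (z : C) : C := Complex (complex.Re z) (- complex.Im z).

Definition climn (u : nat -> C) : C :=
  Complex (limn (fun n => complex.Re (u n))) (limn (fun n => complex.Im (u n))).

Definition conv_series1R (c : nat -> R) : Prop :=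
  exists r : R, 0 < r /\ exists K : R, forall n, `|c n| * r ^+ n <= K.

Definition conv_series1C (c : nat -> C) : Prop :=
  exists r : R, 0 < r /\ exists K : R, forall n, cmod (c n) * r ^+ n <= K.

Definition conv_series2 (c : nat -> nat -> C) : Prop :=
  exists r : R, 0 < r /\ exists K : R,
    forall m n, cmod (c m n) * r ^+ (m + n) <= K.

Definition evalR1 (c : nat -> R) (x : R) : R :=
  limn (fun N => \sum_(n < N) c n * x ^+ n).

Definition evalC1 (c : nat -> C) (x : R) : C :=
  climn (fun N => \sum_(n < N) c n * RtoC (x ^+ n)).

Definition evalC2 (c : nat -> nat -> C) (x y : R) : C :=
  climn (fun N => \sum_(m < N) \sum_(n < N) c m n * RtoC (x ^+ m * y ^+ n)).

Definition unit_series2 (c : nat -> nat -> C) : Prop :=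
  conv_series2 c /\ c 0%N 0%N != 0.

(* Ord g >= k for a function g of a real variable which is (the germ of)
   an analytic function near 0: g = x^k h near 0 with h in C{x}. *)
Definition ord_ge (g : R -> C) (k : nat) : Prop :=
  exists h : nat -> C, conv_series1C h /\
  exists d : R, 0 < d /\ forall x : R, `|x| < d -> g x = RtoC (x ^+ k) * evalC1 h x.

Definition ord_coef_eq (c : nat -> R) (k : nat) : Prop :=
  (forall n, (n < k)%N -> c n = 0) /\ c k != 0.

Definition poly_ord (p : {poly R}) : nat := find (fun a => a != 0) p.

(* O_ij = min { Ord(q_j - q_i), 2L_j, 2L_i }, with Ord 0 = +oo *)
Definition Oij (M : nat) (L : 'I_M -> nat) (q : 'I_M -> {poly R}) (i j : 'I_M) : nat :=
  if q j - q i == 0 then minn (2 * L j) (2 * L i)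
  else minn (poly_ord (q j - q i)) (minn (2 * L j) (2 * L i)).

Definition Pprod (M : nat) (L : 'I_M -> nat) (q : 'I_M -> {poly R}) (x y : R) : C :=
  \prod_(j < M) (RtoC (y + (q j).[x]) + Complex 0 1 * RtoC (x ^+ (2 * L j))).

(* Pbar(x,y) = conj (P(conj x, conj y)); at real points conj x = x *)
Definition Pbar (M : nat) (L : 'I_M -> nat) (q : 'I_M -> {poly R}) (x y : R) : C :=
  cconj (Pprod L q x y).

Definition Afun (M : nat) (L : 'I_M -> nat) (q : 'I_M -> {poly R}) (x y : R) : C :=
  (Pprod L q x y + Pbar L q x y) / RtoC 2.

Definition Bfun (M : nat) (L : 'I_M -> nat) (q : 'I_M -> {poly R}) (x y : R) : C :=
  (Pprod L q x y - Pbar L q x y) / (RtoC 2 * Complex 0 1).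

(* coefficients of q_j - q_i + x^(2L_j) psi_j - x^(2L_i) psi_i *)
Definition branch_diff_coef (M : nat) (L : 'I_M -> nat) (q : 'I_M -> {poly R})
  (psi : 'I_M -> nat -> R) (i j : 'I_M) (n : nat) : R :=
  (q j - q i)`_n
  + (if (2 * L j <= n)%N then psi j (n - 2 * L j)%N else 0)
  - (if (2 * L i <= n)%N then psi i (n - 2 * L i)%N else 0).

(* t is proper, with witnessing factorization data (u, psi):
   A + tB = u * prod_j (y + q_j(x) + x^(2L_j) psi_j(x)) locally *)
Definition proper_factorization (M : nat) (L : 'I_M -> nat) (q : 'I_M -> {poly R})
  (t : R) (u : nat -> nat -> C) (psi : 'I_M -> nat -> R) : Prop :=
  unit_series2 u /\
  (forall j, conv_series1R (psi j)) /\
  (exists d : R, 0 < d /\ forall x y : R, `|x| < d -> `|y| < d ->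
     Afun L q x y + RtoC t * Bfun L q x y
     = evalC2 u x y *
       \prod_(j < M) RtoC (y + (q j).[x] + x ^+ (2 * L j) * evalR1 (psi j) x)) /\
  (forall i j : 'I_M, i != j -> ord_coef_eq (branch_diff_coef L q psi i j) (Oij L q i j)).

Definition branch (M : nat) (L : 'I_M -> nat) (q : 'I_M -> {poly R})
  (psi : 'I_M -> nat -> R) (j : 'I_M) (x : R) : R :=
  - (q j).[x] - x ^+ (2 * L j) * evalR1 (psi j) x.

End Defs.

Definition Lp_loc (R : realType) (p : R) (f : R * R -> R[i]) : Prop :=
  exists U : set (R * R), open U /\ U (0, 0) /\
    measurable_fun U (fun z => complex.Re (f z)) /\
    measurable_fun U (fun z => complex.Im (f z)) /\
    (\int[((@lebesgue_measure R) \x (@lebesgue_measure R))%E]_(z in U)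
        ((cmod (f z)) `^ p)%:E < +oo)%E.

(* Main.v *)
(* On the real plane |P| is comparable to the product of the |y - a_j| + x^(2 L_j),
   whatever the real branches a_j = -q_j - x^(2 L_j) psi_j; the only further input
   is that a_i - a_j has order exactly O_ij.

   If Q is flat enough along the branches, Lagrange interpolation of Q(x, .) at the
   nodes a_j(x) bounds |Q / P| by a constant plus the sum over j of
     |x|^(k_j - sum_(i != j) O_ij) / (|y - a_j| + x^(2 L_j)),
   and (z + w)^-p <= z^-(1-e) w^-(p-1+e) turns the p-th powers into products of
   integrable powers |x|^-(1-e) |y - a_j|^-(1-e), integrated by Tonelli.

   Conversely, if Q(x, a_j(x)) has exact order k, interpolating in the rescaled
   variable (y - a_j) / x^(2 L_j) gives, for every small x > 0, an interval of length
   c x^(2 L_j) on which |Q| >= c' x^k, while |P| = O(x^(sum_i O_ij)) there; when k is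
   too small the sections of |Q / P|^p contribute at least a multiple of 1 / x. *)

Require Import Defs.
From HB Require Import structures.
From mathcomp Require Import all_boot all_order all_algebra.
From mathcomp Require Import all_classical all_reals all_analysis.
From mathcomp Require Import complex measurable_realfun.
From mathcomp Require Import ring lra zify.
Import Order.TTheory GRing.Theory Num.Theory.
Import numFieldNormedType.Exports.
Local Open Scope classical_set_scope.
Local Open Scope ring_scope.
Set Implicit Arguments.
Unset Strict Implicit.

(** * Polynomial interpolation *)

(** The threshold is a count of exponents. If [Q(x, a_j(x))] has order [k], a window of height about
    [x^(2 L_j)] around branch [j] carries [|Q / P|^p] of size [x^((k - O) p)] with [O = sum_i O_ij],
    so the integral behaves like that of [x^((k - O) p + 2 L_j)]. It converges at 0 exactly when
    [(O - k) p < 2 L_j + 1]; since [O - k] is an integer, this says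
    [O - k <= ceil((2 L_j + 1) / p) - 1]. The strict inequality also leaves the room from which the
    small exponent [e] is taken.

    The obstacle is uniformity: the nodes [a_j(x)] all tend to 0 with [x], so the interpolation
    error needs a constant blind to the distances between nodes. Repeated division by linear factors
    provides it, using only coefficient bounds of the form [|c n| * r ^+ n <= K]. These bounds play
    the part of Cauchy estimates throughout, so series are handled over the reals, with the real and
    imaginary parts of [Q] treated separately. *)

Lemma lagrange_interpolation (F : fieldType) (M : nat) (a : 'I_M -> F)
    (p : {poly F}) (y : F) : injective a -> (size p <= M)%N ->
  p.[y] = \sum_(j < M) p.[a j] * \prod_(i < M | i != j) ((y - a i) / (a j - a i)).
Proof.
move=> a_inj szp.
pose l (j : 'I_M) := \prod_(i < M | i != j) ((a j - a i)^-1 *: ('X - (a i)%:P)).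
pose D := p - \sum_(j < M) p.[a j] *: l j.
have lE j z : (l j).[z] = \prod_(i < M | i != j) ((z - a i) / (a j - a i)).
  rewrite horner_prod; apply: eq_bigr => i _.
  by rewrite hornerZ hornerXsubC mulrC.
have szl j : (size (l j) <= M)%N.
  apply: (leq_trans (size_poly_prod_leq _ _)).
  rewrite (@leq_trans ((\sum_(i < M | i != j) 2).+1 - #|[pred i : 'I_M | i != j]|)%N) //.
    rewrite leq_sub2r // ltnS; apply: leq_sum => i _.
    by apply: (leq_trans (size_scale_leq _ _)); rewrite size_XsubC.
  rewrite sum_nat_const (_ : #|_| = M.-1); last first.
    by have := cardC1 j; rewrite card_ord => <-; apply: eq_card => i; rewrite !inE.
  by have := ltn_ord j; lia.
have D0 : D = 0.
  apply: (@roots_geq_poly_eq0 _ _ [seq a j | j <- enum 'I_M]).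
  - apply/allP => _ /mapP[j _ ->]; rewrite rootE !hornerE horner_sum (bigD1 j) //=.
    rewrite hornerZ lE big1 ?mulr1; last first.
      by move=> i ij; rewrite divff // subr_eq0 (inj_eq a_inj) eq_sym.
    rewrite big1 ?addr0 ?subrr // => i ij.
    by rewrite hornerZ lE (bigD1 j) 1?eq_sym //= subrr !mul0r mulr0.
  - by rewrite map_inj_uniq ?enum_uniq.
  - rewrite size_map size_enum_ord (leq_trans (size_polyD _ _)) // geq_max szp size_polyN.
    apply: (leq_trans (size_sum _ _ _)); apply/bigmax_leqP => j _.
    exact: leq_trans (size_scale_leq _ _) (szl j).
have pE : p = \sum_(j < M) p.[a j] *: l j by apply/eqP; rewrite -subr_eq0 -/D D0.
rewrite [in LHS]pE horner_sum; apply: eq_bigr => j _; by rewrite hornerZ lE.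
Qed.

(* The coefficients of the quotient satisfy G_n = F_(n+1) + a G_(n+1); since
   G_n = 0 for large n, the bound propagates downwards. *)
Lemma divXsubC_coef_bound (R : realFieldType) (F : {poly R}) (K rho a : R) :
  0 < rho -> `|a| <= rho / 2 -> (forall n, `|F`_n| * rho ^+ n <= K) ->
  exists G, F = G * ('X - a%:P) + (F.[a])%:P /\
            forall n, `|G`_n| * rho ^+ n <= K * (2 / rho).
Proof.
move=> rho0 ale hF.
have /factor_theorem [G GE] : root (F - (F.[a])%:P) a.
  by rewrite rootE !hornerE subrr.
have FE : F = G * ('X - a%:P) + (F.[a])%:P by rewrite -GE subrK.
exists G; split => //.
have K0 : 0 <= K by apply: le_trans (hF 0%N); rewrite mulr_ge0 // exprn_ge0 // ltW.
have coefG n : G`_n = F`_n.+1 + a * G`_n.+1.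
  rewrite [in RHS]FE coefD coefC /= addr0 mulrBr coefB coefMX /= coefMC.
  by rewrite mulrC subrK.
have B0 : 0 <= K * (2 / rho) by rewrite mulr_ge0 // divr_ge0 // ltW.
suff H m n : (size G <= n + m)%N -> `|G`_n| * rho ^+ n <= K * (2 / rho).
  by move=> n; apply: (H (size G)); rewrite leq_addl.
elim: m n => [|m IH] n szG.
  by rewrite nth_default ?normr0 ?mul0r //; rewrite addn0 in szG.
have IHn : `|G`_n.+1| * rho ^+ n.+1 <= K * (2 / rho) by apply: IH; lia.
have hFn := hF n.+1.
have rn0 : 0 < rho ^+ n by rewrite exprn_gt0.
rewrite coefG; apply: (@le_trans _ _ ((`|F`_n.+1| + rho / 2 * `|G`_n.+1|) * rho ^+ n)).
  rewrite ler_wpM2r ?(ltW rn0) // (le_trans (ler_normD _ _)) // lerD2l normrM.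
  by rewrite ler_wpM2r.
rewrite (_ : _ * _ = (`|F`_n.+1| * rho ^+ n.+1) / rho + (`|G`_n.+1| * rho ^+ n.+1) / 2); last first.
  by rewrite exprS; field; rewrite gt_eqF.
have h1 : `|F`_n.+1| * rho ^+ n.+1 / rho <= K / rho by rewrite ler_pM2r // invr_gt0.
have h2 : `|G`_n.+1| * rho ^+ n.+1 / 2 <= K / rho.
  by rewrite ler_pdivrMr //; apply: le_trans IHn _; rewrite le_eqVlt; apply/orP; left; apply/eqP; ring.
by apply: le_trans (lerD h1 h2) _; rewrite le_eqVlt; apply/orP; left; apply/eqP; ring.
Qed.

(** One division per node, as in Newton's form of the interpolant: each costs a factor [2 / rho],
    wherever the nodes lie in the half disc, and repeated nodes are allowed. *)
Lemma newton_coef_bound (R : realFieldType) (K rho : R) (s : seq R) (F : {poly R}) :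
  0 < rho -> (forall a, a \in s -> `|a| <= rho / 2) ->
  (forall n, `|F`_n| * rho ^+ n <= K) ->
  exists G N : {poly R}, [/\ F = G * \prod_(a <- s) ('X - a%:P) + N,
     (size N <= size s)%N &
     forall n, `|G`_n| * rho ^+ n <= K * (2 / rho) ^+ size s].
Proof.
move=> rho0; elim: s K F => [|a s IH] K F hs hF.
  by exists F, 0; rewrite big_nil mulr1 addr0 size_poly0 expr0; split=> // n; rewrite mulr1.
have [G [FE hG]] := divXsubC_coef_bound rho0 (hs a (mem_head _ _)) hF.
have hs' b : b \in s -> `|b| <= rho / 2.
  by move=> bs; apply: hs; rewrite in_cons bs orbT.
have [G' [N [GE szN hG']]] := IH _ _ hs' hG.
exists G', (N * ('X - a%:P) + (F.[a])%:P); split.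
- by rewrite [in LHS]FE {1}GE big_cons mulrDl addrA; congr (_ + _ + _); ring.
- rewrite (leq_trans (size_polyD _ _)) // geq_max (leq_trans (size_polyC_leq1 _)) // andbT.
  by rewrite (leq_trans (size_polyMleq _ _)) // size_XsubC addn2 ltnS.
- by move=> n; rewrite /= exprS mulrA.
Qed.

Lemma geo_sum_half (R : realFieldType) (th : R) N : 0 <= th <= 1 / 2 ->
  \sum_(n < N) th ^+ n <= 2.
Proof.
move=> /andP[t0 t1]; apply: (@le_trans _ _ (2 - 2 * th ^+ N)); last by rewrite gerBl mulr_ge0 ?exprn_ge0.
elim: N => [|N IH]; first by rewrite big_ord0 expr0; lra.
rewrite big_ord_recr /= exprS; apply: le_trans (lerD IH (lexx _)) _.
by have := exprn_ge0 N t0; nra.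
Qed.

Lemma horner_bound (R : realFieldType) (K rho y : R) (G : {poly R}) :
  0 < rho -> `|y| <= rho / 2 -> (forall n, `|G`_n| * rho ^+ n <= K) -> `|G.[y]| <= 2 * K.
Proof.
move=> rho0 hy hG.
have K0 : 0 <= K by apply: le_trans (hG 0%N); rewrite mulr_ge0 // exprn_ge0 // ltW.
have rn0 n : 0 < rho ^+ n by rewrite exprn_gt0.
rewrite horner_coef (le_trans (ler_norm_sum _ _ _)) //.
apply: (@le_trans _ _ (\sum_(i < size G) K * (`|y| / rho) ^+ i)).
  apply: ler_sum => i _; rewrite normrM normrX expr_div_n mulrA ler_pdivlMr //.
  by rewrite mulrAC ler_wpM2r // exprn_ge0.
rewrite -mulr_sumr mulrC ler_wpM2r // geo_sum_half //.
by rewrite divr_ge0 ?(ltW rho0) //= ler_pdivrMr // mul1r mulrC.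
Qed.

(** The remainder [N] of the successive divisions agrees with [F] at the nodes and has size at most
    [M], so it is the Lagrange interpolant; what is left is the quotient times the product of the
    [y - a j]. The constant depends on [K], [rho] and [M] alone, so it survives the collision of the
    nodes. *)
Lemma interpolation_error (R : realFieldType) (K rho : R) (M : nat)
    (a : 'I_M -> R) (F : {poly R}) (y : R) :
  0 < rho -> injective a -> (forall j, `|a j| <= rho / 2) -> `|y| <= rho / 2 ->
  (forall n, `|F`_n| * rho ^+ n <= K) ->
  `|F.[y] - \sum_(j < M) F.[a j] * \prod_(i < M | i != j) ((y - a i) / (a j - a i))|
    <= 2 * (K * (2 / rho) ^+ M) * \prod_(j < M) `|y - a j|.
Proof.
move=> rho0 a_inj ha hy hF.
have hs b : b \in [seq a j | j <- enum 'I_M] -> `|b| <= rho / 2.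
  by move=> /mapP[j _ ->].
have [G [N [FE szN hG]]] := newton_coef_bound rho0 hs hF.
rewrite size_map size_enum_ord in szN hG.
rewrite big_map big_enum /= in FE.
have prodE z : (\prod_(j < M) ('X - (a j)%:P)).[z] = \prod_(j < M) (z - a j).
  by rewrite horner_prod; apply: eq_bigr => j _; rewrite hornerXsubC.
have FN j : F.[a j] = N.[a j].
  by rewrite FE hornerD hornerM prodE (bigD1 j) //= subrr mul0r mulr0 add0r.
under eq_bigr do rewrite FN.
rewrite -(@lagrange_interpolation _ _ a N y) // FE hornerD addrK hornerM prodE normrM normr_prod.
by rewrite ler_wpM2r ?prodr_ge0 // (@horner_bound _ _ rho).
Qed.

(** * Power series in one variable *)

Lemma cvgn_dist_le (R : realType) (u : nat -> R) (l c e : R) (N : nat) :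
  u @ \oo --> l -> (forall n, (N <= n)%N -> `|u n - c| <= e) -> `|l - c| <= e.
Proof.
move=> ul ue.
have : (fun n => `|u n - c|) @ \oo --> `|l - c|.
  by apply: cvg_norm; apply: cvgB => //; exact: cvg_cst.
by move=> /cvgr_to_le; apply; exists N => // n /= /ue.
Qed.

Lemma geometric_increments_cvg (R : realType) (u : nat -> R) (K th : R) :
  0 <= th <= 1 / 2 -> (forall n, `|u n.+1 - u n| <= K * th ^+ n) -> cvgn u.
Proof.
move=> /andP[t0 t1] hu.
have K0 : 0 <= K by have := le_trans (normr_ge0 _) (hu 0%N); rewrite expr0 mulr1.
have : cvgn (series (fun n => u n.+1 - u n)).
  apply: normed_cvg; apply: (@series_le_cvg _ _ (geometric K th)) => [n|n|n|].
  - exact: normr_ge0.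
  - by rewrite /geometric /= mulr_ge0 // exprn_ge0.
  - exact: hu.
  - by apply: is_cvg_geometric_series; rewrite ger0_norm //; lra.
have -> : series (fun n => u n.+1 - u n) = (fun n => u n - u 0%N).
  by apply/funext => n; rewrite /series /= telescope_sumr.
move=> h; have -> : u = (fun n => (u n - u 0%N) + u 0%N).
  by apply/funext => n; rewrite subrK.
by apply: is_cvgD => //; exact: is_cvg_cst.
Qed.

Definition psum1 (R : realType) (c : nat -> R) (x : R) (N : nat) : R :=
  \sum_(n < N) c n * x ^+ n.

(** The function is tied to its coefficients by convergence instead of being defined as a limit, so
    that closure under sums, shifts and composition reduces to limits of partial sums. One radius
    serves both the coefficient bound and the convergence. *)
Definition is_ps (R : realType) (f : R -> R) (c : nat -> R) : Prop :=
  exists r K : R, [/\ 0 < r, forall n, `|c n| * r ^+ n <= K &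
    forall x, `|x| <= r -> psum1 c x @ \oo --> f x].

Lemma is_psW (R : realType) (f : R -> R) (c : nat -> R) (d : R) : 0 < d -> is_ps f c ->
  exists r K : R, [/\ 0 < r <= d, 0 <= K, forall n, `|c n| * r ^+ n <= K &
    forall x, `|x| <= r -> psum1 c x @ \oo --> f x].
Proof.
move=> d0 [r [K [r0 hc hf]]]; exists (Num.min r d), K.
have m0 : 0 < Num.min r d by rewrite lt_min r0.
split.
- by rewrite m0 ge_min lexx orbT.
- by apply: le_trans (hc 0%N); rewrite mulr_ge0 // exprn_ge0 // ltW.
- move=> n; apply: le_trans (hc n); rewrite ler_wpM2l // lerXn2r ?nnegrE ?(ltW m0) ?(ltW r0) //.
  by rewrite ge_min lexx.
- by move=> x hx; apply: hf; apply: le_trans hx _; rewrite ge_min lexx.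
Qed.

Lemma is_ps_evalR1 (R : realType) (c : nat -> R) : conv_series1R c -> is_ps (evalR1 c) c.
Proof.
move=> [r [r0 [K hc]]]; exists (r / 2), K; split; first by rewrite divr_gt0.
  move=> n; apply: le_trans (hc n); rewrite ler_wpM2l // lerXn2r ?nnegrE ?(ltW r0) //.
    by rewrite divr_ge0 // ltW.
  by rewrite ler_pdivrMr //; lra.
(* The radius was halved so that the terms decay with ratio [|x| / r <= 1 / 2]; the same halving
   recurs in all later tail estimates. *)
move=> x hx; apply: (@geometric_increments_cvg _ _ K (`|x| / r)).
  by rewrite divr_ge0 ?(ltW r0) //= ler_pdivrMr // mul1r mulrC.
move=> n; rewrite /psum1 big_ord_recr /= addrAC subrr add0r normrM normrX expr_div_n mulrA.
by rewrite ler_pdivlMr ?exprn_gt0 // mulrAC ler_wpM2r // exprn_ge0.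
Qed.

Lemma is_psD (R : realType) (f g : R -> R) (c d : nat -> R) :
  is_ps f c -> is_ps g d -> is_ps (fun x => f x + g x) (fun n => c n + d n).
Proof.
move=> /(is_psW ltr01) [r [K [/andP[r0 _] _ hc hf]]].
move=> /(is_psW r0) [s [B [/andP[s0 sr] _ hd hg]]].
exists s, (K + B); split => //.
  move=> n; apply: (@le_trans _ _ ((`|c n| + `|d n|) * s ^+ n)).
    by rewrite ler_wpM2r ?ler_normD // exprn_ge0 // ltW.
  rewrite mulrDl lerD //; apply: le_trans (hc n); by rewrite ler_wpM2l // lerXn2r ?nnegrE ?(ltW s0) ?(ltW r0).
move=> x hx; have -> : psum1 (fun n => c n + d n) x = (fun N => psum1 c x N + psum1 d x N).
  apply/funext => N; rewrite /psum1 -big_split /=; apply: eq_bigr => i _; exact: mulrDl.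
by apply: cvgD; [apply: hf; apply: le_trans sr | apply: hg].
Qed.

Lemma is_psN (R : realType) (f : R -> R) (c : nat -> R) :
  is_ps f c -> is_ps (fun x => - f x) (fun n => - c n).
Proof.
move=> [r [K [r0 hc hf]]]; exists r, K; split => // [n|x hx]; first by rewrite normrN.
have -> : psum1 (fun n => - c n) x = (fun N => - psum1 c x N).
  apply/funext => N; rewrite /psum1 -sumrN; apply: eq_bigr => i _; exact: mulNr.
by apply: cvgN; apply: hf.
Qed.

Lemma is_ps_poly (R : realType) (p : {poly R}) : is_ps (fun x => p.[x]) (fun n => p`_n).
Proof.
exists 1, (\sum_(i < size p) `|p`_i|); split => //.
  move=> n; rewrite expr1n mulr1; have [sn|ns] := leqP (size p) n.
    by rewrite nth_default // normr0 sumr_ge0.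
  by rewrite (bigD1 (Ordinal ns)) //= lerDl sumr_ge0.
move=> x _; apply: cvg_near_cst; exists (size p) => // n /= sn.
by rewrite /psum1 (@horner_coef_wide _ n).
Qed.

Lemma is_ps_shift (R : realType) (f : R -> R) (c : nat -> R) (k : nat) :
  is_ps f c ->
  is_ps (fun x => x ^+ k * f x) (fun n => if (k <= n)%N then c (n - k)%N else 0).
Proof.
move=> /(is_psW ltr01) [r [K [/andP[r0 r1] K0 hc hf]]]; exists r, K; split => //.
  move=> n; case: leqP => kn; last by rewrite normr0 mul0r.
  apply: le_trans (hc (n - k)%N); rewrite ler_wpM2l //.
  by rewrite ler_wiXn2l ?(ltW r0) // leq_subr.
move=> x hx; rewrite -(cvg_shiftn k).
have -> : (fun N => psum1 (fun n => if (k <= n)%N then c (n - k)%N else 0) x (N + k)%N)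
   = (fun N => x ^+ k * psum1 c x N).
  apply/funext => N; rewrite /psum1 addnC big_split_ord /= big1 ?add0r; last first.
    by move=> i _; rewrite leqNgt ltn_ord mul0r.
  rewrite mulr_sumr; apply: eq_bigr => i _.
  by rewrite leq_addr addKn exprD; ring.
by apply: cvgM; [exact: cvg_cst | exact: hf].
Qed.

Lemma sum_shift_geo (R : realType) (c : nat -> R) (K r x : R) (N m : nat) : 0 < r ->
  `|x| <= r / 2 -> (forall n, `|c n| * r ^+ n <= K) ->
  `|\sum_(i < m) c (N + i)%N * x ^+ (N + i)| <= 2 * K * (`|x| / r) ^+ N.
Proof.
move=> r0 hx hc.
have K0 : 0 <= K by apply: le_trans (hc 0%N); rewrite mulr_ge0 // exprn_ge0 // ltW.
apply: (le_trans (ler_norm_sum _ _ _)).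
apply: (@le_trans _ _ (\sum_(i < m) K * (`|x| / r) ^+ N * (`|x| / r) ^+ i)).
  apply: ler_sum => i _; rewrite -mulrA -exprD normrM normrX expr_div_n mulrA.
  by rewrite ler_pdivlMr ?exprn_gt0 // mulrAC ler_wpM2r // exprn_ge0.
rewrite -mulr_sumr mulrC -mulrA ler_wpM2r ?geo_sum_half //.
  by rewrite mulr_ge0 // exprn_ge0 // divr_ge0 // ltW.
by rewrite divr_ge0 ?(ltW r0) //= ler_pdivrMr // mul1r mulrC.
Qed.

Lemma is_ps_taylor (R : realType) (f : R -> R) (c : nat -> R) (N : nat) : is_ps f c ->
  exists r K : R, [/\ 0 < r, 0 <= K & forall x, `|x| <= r ->
    `|f x - psum1 c x N| <= K * `|x| ^+ N].
Proof.
move=> /(is_psW ltr01) [r [K [/andP[r0 _] K0 hc hf]]].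
exists (r / 2), (2 * K / r ^+ N); split.
- by rewrite divr_gt0.
- by rewrite divr_ge0 ?exprn_ge0 ?mulr_ge0 // ltW.
move=> x hx; have xr : `|x| <= r by apply: le_trans hx _; lra.
apply: (cvgn_dist_le (N := N) (hf _ xr)) => n Nn.
rewrite -(subnKC Nn) /psum1 big_split_ord /= addrAC subrr add0r.
rewrite (_ : _ * _ = 2 * K * (`|x| / r) ^+ N); last by rewrite expr_div_n; ring.
exact: (@sum_shift_geo _ c).
Qed.

Lemma is_ps_ord (R : realType) (f : R -> R) (c : nat -> R) (k : nat) : is_ps f c ->
  (forall n, (n < k)%N -> c n = 0) ->
  exists h : nat -> R, conv_series1R h /\
  exists d : R, 0 < d /\ forall x : R, `|x| < d -> f x = x ^+ k * evalR1 h x.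
Proof.
move=> [r [K [r0 hc hf]]] c0; exists (fun n => c (k + n)%N).
have hh : conv_series1R (fun n => c (k + n)%N).
  exists r; split => //; exists (K / r ^+ k) => n.
  by rewrite ler_pdivlMr ?exprn_gt0 // -mulrA -exprD addnC.
split => //; have [r' [K' [r'0 _ hf']]] := is_ps_evalR1 hh.
exists (Num.min r r'); split; first by rewrite lt_min r0.
move=> x; rewrite lt_min => /andP[/ltW xr /ltW xr'].
have h1 := hf _ xr; rewrite -(cvg_shiftn k) in h1.
have h2 : (fun N => psum1 c x (N + k)%N) @ \oo --> x ^+ k * evalR1 (fun n => c (k + n)%N) x.
  have -> : (fun N => psum1 c x (N + k)%N) = (fun N => x ^+ k * psum1 (fun n => c (k + n)%N) x N).
    apply/funext => N; rewrite /psum1 addnC big_split_ord /= big1 ?add0r; last first.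
      by move=> i _; rewrite c0 // mul0r.
    by rewrite mulr_sumr; apply: eq_bigr => i _; rewrite exprD; ring.
  by apply: cvgM; [exact: cvg_cst | exact: hf'].
exact: (cvg_unique _ h1 h2).
Qed.

(** * Double power series *)

Definition psum2 (R : realType) (c : nat -> nat -> R) (x y : R) (N : nat) : R :=
  \sum_(m < N) \sum_(n < N) c m n * (x ^+ m * y ^+ n).

Definition evalR2 (R : realType) (c : nat -> nat -> R) (x y : R) : R :=
  limn (psum2 c x y).

Definition coef2_le (R : realType) (c : nat -> nat -> R) (r K : R) : Prop :=
  0 < r /\ forall m n, `|c m n| * r ^+ (m + n) <= K.

(** The square truncation at fixed [x], read as a polynomial in [y]. Its coefficient bounds are free
    of [N] and [x], so polynomial interpolation applies to it and passes to the limit with the same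
    constant. *)
Definition ypoly (R : realType) (c : nat -> nat -> R) (x : R) (N : nat) : {poly R} :=
  \poly_(n < N) \sum_(m < N) c m n * x ^+ m.

Lemma coef2_le_ge0 (R : realType) (c : nat -> nat -> R) (r K : R) :
  coef2_le c r K -> 0 <= K.
Proof.
by move=> [r0 hc]; apply: le_trans (hc 0%N 0%N); rewrite mulr_ge0 // exprn_ge0 // ltW.
Qed.

Lemma horner_ypoly (R : realType) (c : nat -> nat -> R) (x y : R) (N : nat) :
  (ypoly c x N).[y] = psum2 c x y N.
Proof.
rewrite horner_poly /psum2 exchange_big /=; apply: eq_bigr => n _.
by rewrite mulr_suml; apply: eq_bigr => m _; rewrite mulrA.
Qed.

Lemma term2_le (R : realType) (c : nat -> nat -> R) (r K x y : R) (m n : nat) :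
  coef2_le c r K -> `|x| <= r / 2 -> `|y| <= r / 2 ->
  `|c m n * (x ^+ m * y ^+ n)| <= K * (1 / 2) ^+ m * (1 / 2) ^+ n.
Proof.
move=> [r0 hc] hx hy.
have r20 : 0 <= r / 2 by rewrite divr_ge0 // ltW.
apply: (@le_trans _ _ (`|c m n| * ((r / 2) ^+ m * (r / 2) ^+ n))).
  rewrite !normrM !normrX ler_wpM2l // ler_pM ?exprn_ge0 // lerXn2r ?nnegrE //.
rewrite (_ : _ * _ = (`|c m n| * r ^+ (m + n)) * ((1 / 2) ^+ m * (1 / 2) ^+ n)).
  by rewrite -[X in _ <= X]mulrA ler_wpM2r // mulr_ge0 // exprn_ge0.
by rewrite exprD !expr_div_n !expr1n; ring.
Qed.

Lemma psum2_cvg (R : realType) (c : nat -> nat -> R) (r K x y : R) :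
  coef2_le c r K -> `|x| <= r / 2 -> `|y| <= r / 2 ->
  psum2 c x y @ \oo --> evalR2 c x y.
Proof.
move=> hc hx hy; have K0 := coef2_le_ge0 hc.
have half0 : 0 <= 1 / 2 :> R by rewrite divr_ge0.
have half : 0 <= (1 / 2 : R) <= (1 / 2 : R) by rewrite half0 lexx.
apply: (@geometric_increments_cvg _ _ (4 * K) (1 / 2)) => // N.
(* Going from one square to the next adds an L-shaped set of indices; each of its two arms is a
   geometric sum of size at most [2 * K * (1 / 2) ^+ N]. *)
have -> : psum2 c x y N.+1 - psum2 c x y N =
   \sum_(m < N) c m N * (x ^+ m * y ^+ N) + \sum_(n < N.+1) c N n * (x ^+ N * y ^+ n).
  rewrite /psum2 big_ord_recr /= addrAC; congr (_ + _).
  by rewrite -sumrB; apply: eq_bigr => m _; rewrite big_ord_recr /= addrAC subrr add0r.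
have h1 : `|\sum_(m < N) c m N * (x ^+ m * y ^+ N)| <= 2 * K * (1 / 2) ^+ N.
  apply: (le_trans (ler_norm_sum _ _ _)).
  apply: (@le_trans _ _ (\sum_(m < N) K * (1 / 2) ^+ N * (1 / 2) ^+ m)).
    by apply: ler_sum => m _; rewrite [X in _ <= X]mulrAC; exact: (term2_le _ _ hc).
  rewrite -mulr_sumr mulrC -mulrA ler_wpM2r ?geo_sum_half //.
  by rewrite mulr_ge0 // exprn_ge0.
have h2 : `|\sum_(n < N.+1) c N n * (x ^+ N * y ^+ n)| <= 2 * K * (1 / 2) ^+ N.
  apply: (le_trans (ler_norm_sum _ _ _)).
  apply: (@le_trans _ _ (\sum_(n < N.+1) K * (1 / 2) ^+ N * (1 / 2) ^+ n)).
    by apply: ler_sum => m _; exact: (term2_le _ _ hc).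
  rewrite -mulr_sumr mulrC -mulrA ler_wpM2r ?geo_sum_half //.
  by rewrite mulr_ge0 // exprn_ge0.
apply: (le_trans (ler_normD _ _)); apply: le_trans (lerD h1 h2) _.
by rewrite le_eqVlt; apply/orP; left; apply/eqP; ring.
Qed.

Lemma coef_ypoly_le (R : realType) (c : nat -> nat -> R) (r K x : R) (N n : nat) :
  coef2_le c r K -> `|x| <= r / 2 -> `|(ypoly c x N)`_n| * r ^+ n <= 2 * K.
Proof.
move=> hc hx; have K0 := coef2_le_ge0 hc; have r0 := hc.1.
rewrite coef_poly; case: ifP => _; last by rewrite normr0 mul0r mulr_ge0.
rewrite -ler_pdivlMr ?exprn_gt0 //.
have -> : \sum_(m < N) c m n * x ^+ m = \sum_(m < N) c (0 + m)%N n * x ^+ (0 + m)%N by [].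
apply: le_trans (@sum_shift_geo _ (fun m => c m n) (K / r ^+ n) r x 0 N r0 hx _) _.
  by move=> m; rewrite ler_pdivlMr ?exprn_gt0 // -mulrA -exprD; exact: hc.2.
by rewrite expr0 mulr1 mulrA.
Qed.

Lemma evalR2_interpolation (R : realType) (c : nat -> nat -> R) (r K x y : R)
    (M : nat) (a : 'I_M -> R) :
  coef2_le c r K -> injective a -> `|x| <= r / 2 -> `|y| <= r / 2 ->
  (forall j, `|a j| <= r / 2) ->
  `|evalR2 c x y - \sum_(j < M) evalR2 c x (a j) *
       \prod_(i < M | i != j) ((y - a i) / (a j - a i))|
    <= 2 * (2 * K * (2 / r) ^+ M) * \prod_(j < M) `|y - a j|.
Proof.
move=> hc a_inj hx hy ha; rewrite -[X in `|X|]subr0.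
apply: (@cvgn_dist_le _ (fun N => psum2 c x y N - \sum_(j < M) psum2 c x (a j) N *
       \prod_(i < M | i != j) ((y - a i) / (a j - a i))) _ _ _ 0).
  apply: cvgB; first exact: (psum2_cvg hc).
  apply: cvg_big => [|j _]; first exact: add_continuous.
  apply: cvgM; last exact: cvg_cst.
  exact: (psum2_cvg hc).
move=> N _; rewrite subr0 -horner_ypoly.
under eq_bigr do rewrite -horner_ypoly.
apply: interpolation_error => //; first exact: hc.1.
by move=> n; apply: (coef_ypoly_le _ _ hc).
Qed.

(** Interpolation at the single node [z]: the interpolant is constant, and the error estimate
    becomes a Lipschitz bound uniform in [N]. *)
Lemma psum2_lipschitz (R : realType) (c : nat -> nat -> R) (r K x y z : R) (N : nat) :
  coef2_le c r K -> `|x| <= r / 2 -> `|y| <= r / 2 -> `|z| <= r / 2 ->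
  `|psum2 c x y N - psum2 c x z N| <= 2 * (2 * K * (2 / r)) * `|y - z|.
Proof.
move=> hc hx hy hz.
have := @interpolation_error _ (2 * K) r 1 (fun=> z) (ypoly c x N) y hc.1 _ (fun=> hz) hy
  (fun n => coef_ypoly_le N n hc hx).
rewrite !big_ord1 big1 ?mulr1 ?expr1 ?horner_ypoly; last by move=> i; rewrite ord1 eqxx.
by apply => i j _; rewrite !ord1.
Qed.

(** * Weighted coefficient norms and composition with a branch *)

Definition pnorm (R : realType) (rho : R) (p : {poly R}) : R :=
  (\poly_(i < size p) `|p`_i|).[rho].

Lemma pnormE (R : realType) (rho : R) (p : {poly R}) (N : nat) : (size p <= N)%N ->
  pnorm rho p = \sum_(i < N) `|p`_i| * rho ^+ i.
Proof.
move=> szp; rewrite /pnorm horner_poly (big_ord_widen_cond N (fun _ => true) (fun i => `|p`_i| * rho ^+ i)) //=.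
rewrite big_mkcond /=; apply: eq_bigr => i _; case: ltnP => // h.
by rewrite nth_default // normr0 mul0r.
Qed.

Lemma pnorm_ge0 (R : realType) (rho : R) (p : {poly R}) : 0 <= rho -> 0 <= pnorm rho p.
Proof.
by move=> r0; rewrite (pnormE _ (leqnn _)) sumr_ge0 // => i _; rewrite mulr_ge0 // exprn_ge0.
Qed.

Lemma pnorm_coef (R : realType) (rho : R) (p : {poly R}) n : 0 <= rho ->
  `|p`_n| * rho ^+ n <= pnorm rho p.
Proof.
move=> r0; have [sn|ns] := leqP (size p) n.
  by rewrite nth_default // normr0 mul0r pnorm_ge0.
rewrite (pnormE _ (leqnn _)) (bigD1 (Ordinal ns)) //= lerDl sumr_ge0 // => i _.
by rewrite mulr_ge0 // exprn_ge0.
Qed.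

Lemma pnormD (R : realType) (rho : R) (p q : {poly R}) : 0 <= rho ->
  pnorm rho (p + q) <= pnorm rho p + pnorm rho q.
Proof.
move=> r0; rewrite !(@pnormE _ rho _ (maxn (size p) (size q))) ?size_polyD ?leq_maxl ?leq_maxr //.
rewrite -big_split /=; apply: ler_sum => i _.
by rewrite -mulrDl coefD ler_wpM2r ?ler_normD // exprn_ge0.
Qed.

Lemma pnorm0 (R : realType) (rho : R) : pnorm rho 0 = 0.
Proof. by rewrite (@pnormE _ _ _ 0) ?size_poly0 // big_ord0. Qed.

Lemma pnorm_sum (R : realType) (rho : R) (I : Type) (s : seq I) (F : I -> {poly R}) :
  0 <= rho -> pnorm rho (\sum_(i <- s) F i) <= \sum_(i <- s) pnorm rho (F i).
Proof.
move=> r0; elim: s => [|i s IH]; first by rewrite !big_nil pnorm0.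
by rewrite !big_cons (le_trans (pnormD _ _ r0)) // lerD2l.
Qed.

Lemma pnormZ (R : realType) (rho a : R) (p : {poly R}) :
  pnorm rho (a *: p) = `|a| * pnorm rho p.
Proof.
rewrite !(@pnormE _ _ _ (size p)) ?size_scale_leq // mulr_sumr.
by apply: eq_bigr => i _; rewrite coefZ normrM mulrA.
Qed.

Lemma pnormXn (R : realType) (rho : R) (m : nat) : pnorm rho 'X^m = rho ^+ m.
Proof.
rewrite (@pnormE _ _ _ m.+1) ?size_polyXn // big_ord_recr /= big1 ?add0r.
  by rewrite coefXn eqxx normr1 mul1r.
by move=> i _; rewrite coefXn ltn_eqF ?normr0 ?mul0r.
Qed.

Lemma pnormMXn (R : realType) (rho : R) (p : {poly R}) (m : nat) :
  pnorm rho (p * 'X^m) = pnorm rho p * rho ^+ m.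
Proof.
rewrite (@pnormE _ _ (p * 'X^m) (m + size p)); last first.
  by rewrite (leq_trans (size_polyMleq _ _)) // size_polyXn; lia.
rewrite (pnormE _ (leqnn _)) big_split_ord /= big1 ?add0r; last first.
  by move=> i _; rewrite coefMXn ltn_ord normr0 mul0r.
rewrite mulr_suml; apply: eq_bigr => i _.
by rewrite coefMXn ltnNge leq_addr /= addKn exprD; ring.
Qed.

(** Submultiplicativity is the point of this weighted l1 norm: it bounds every power of the
    truncated inner series by a power of one number, whatever the truncation order. *)
Lemma pnormM (R : realType) (rho : R) (p q : {poly R}) : 0 <= rho ->
  pnorm rho (p * q) <= pnorm rho p * pnorm rho q.
Proof.
move=> r0; rewrite -[q in X in X <= _]coefK poly_def mulr_sumr.
apply: (le_trans (pnorm_sum _ _ r0)).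
rewrite [pnorm rho q](pnormE _ (leqnn _)) mulr_sumr; apply: ler_sum => i _.
by rewrite -scalerAr pnormZ pnormMXn mulrCA.
Qed.

Lemma pnormX (R : realType) (rho : R) (p : {poly R}) (n : nat) : 0 <= rho ->
  pnorm rho (p ^+ n) <= pnorm rho p ^+ n.
Proof.
move=> r0; elim: n => [|n IH]; first by rewrite expr0 -(expr0 'X) pnormXn !expr0.
rewrite !exprS (le_trans (pnormM _ _ r0)) // ler_wpM2l // pnorm_ge0 //.
Qed.

Lemma norm_le_cvg0 (R : realType) (u v : nat -> R) :
  (forall n, `|u n| <= v n) -> v @ \oo --> 0 -> u @ \oo --> 0.
Proof.
move=> uv v0; apply: norm_cvg0; apply: (@squeeze_cvgr _ _ _ _ (cst 0) v) => //.
  by near=> n; rewrite normr_ge0 uv.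
exact: cvg_cst.
Unshelve. all: by end_near. Qed.

Lemma dvdp_sum_ord (F : fieldType) (d : {poly F}) (n : nat) (f : 'I_n -> {poly F}) :
  (forall i, (d %| f i)%R) -> (d %| \sum_i f i)%R.
Proof.
by move=> h; apply: (big_ind (fun p => (d %| p)%R)) => [|p q dp dq|i _];
  [exact: dvdp0|exact: dvdp_add|exact: h].
Qed.

Section composition.
Variables (R : realType) (c : nat -> nat -> R) (al : nat -> R).

Let trunc N : {poly R} := \poly_(i < N) al i.

(* Truncating both series at order N computes the coefficients of the composite
   below N exactly, provided the inner series has no constant term. *)
Let G N : {poly R} := \sum_(m < N) \sum_(n < N) c m n *: ('X^m * trunc N ^+ n).

Lemma comp_trunc_stable N k : al 0%N = 0 -> (k < N)%N -> (G N.+1)`_k = (G N)`_k.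
Proof.
move=> al0 kN.
have truncS : trunc N.+1 - trunc N = al N *: 'X^N.
  by rewrite /trunc !poly_def big_ord_recr /= addrAC subrr add0r.
have dX : ('X %| trunc N.+1)%R.
  rewrite /trunc poly_def; apply: dvdp_sum_ord => -[[|i] hi] /=; first by rewrite al0 scale0r dvdp0.
  by rewrite -mul_polyC dvdp_mull ?exprS ?dvdp_mulIl.
(* Three sources of change, each divisible by ['X^N]: the inner truncation moves by [al N *: 'X^N],
   the new terms [n = N] carry [trunc N.+1 ^+ N] with ['X] dividing [trunc N.+1], and the new terms
   [m = N] carry ['X^N]. *)
have : ('X^N %| G N.+1 - G N)%R.
  have -> : G N.+1 - G N =
     \sum_(m < N) (\sum_(n < N) c m n *: ('X^m * (trunc N.+1 ^+ n - trunc N ^+ n))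
       + c m N *: ('X^m * trunc N.+1 ^+ N))
     + \sum_(n < N.+1) c N n *: ('X^N * trunc N.+1 ^+ n).
    rewrite /G big_ord_recr /= addrAC; congr (_ + _).
    rewrite -sumrB; apply: eq_bigr => m _; rewrite big_ord_recr /= addrAC; congr (_ + _).
    by rewrite -sumrB; apply: eq_bigr => n _; rewrite -scalerBr mulrBr.
  rewrite dvdp_add //; apply: dvdp_sum_ord => i.
  - rewrite dvdp_add //; last first.
      by rewrite -mul_polyC dvdp_mull // dvdp_mull // dvdp_exp2r.
    apply: dvdp_sum_ord => n; rewrite -mul_polyC dvdp_mull // dvdp_mull // subrXX truncS.
    by rewrite dvdp_mulr // -mul_polyC dvdp_mull.
  - by rewrite -mul_polyC dvdp_mull // dvdp_mulIl.
move=> /dvdpP[q qE]; apply/eqP; rewrite -subr_eq0 -coefB qE coefMXn kN //.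
Qed.

Lemma comp_trunc_coef N k : al 0%N = 0 -> (k < N)%N -> (G N)`_k = (G k.+1)`_k.
Proof.
move=> al0; elim: N => // N IH; rewrite ltnS leq_eqVlt => /orP[/eqP->//|kN].
by rewrite comp_trunc_stable // IH.
Qed.

(** The converse direction must produce a convergent series for [Q(x, a_j(x))], because [ord_ge]
    asks for one and a growth bound would not suffice. *)
Lemma is_ps_comp (a : R -> R) (r K : R) : coef2_le c r K -> is_ps a al -> al 0%N = 0 ->
  exists g, is_ps (fun x => evalR2 c x (a x)) g.
Proof.
move=> hc ha al0; have r0 := hc.1; have K0 := coef2_le_ge0 hc.
have [ra [Ka [/andP[ra0 _] Ka0 hal hacvg]]] := is_psW ltr01 ha.
have half : 0 <= (1 / 2 : R) <= (1 / 2 : R) by rewrite lexx divr_ge0.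
(* The last condition puts the majorant of the inner series at [rho] below [r / 2]: without constant
   term, that majorant is at most [2 * Ka * (rho / ra)]. The norms of all [G N] at [rho] are then
   bounded by a double geometric sum. *)
have [rho [rho0 rho1 rho2 rho3]] : exists rho : R, [/\ 0 < rho, rho <= ra / 2, rho <= r / 2
    & 2 * Ka * (rho / ra) <= r / 2].
  exists (Num.min (ra / 2) (Num.min (r / 2) (r * ra / (4 * (Ka + 1))))); split.
  - by rewrite !lt_min !divr_gt0 //; rewrite ?mulr_gt0 // ltr_wpDl.
  - by rewrite ge_min lexx.
  - by rewrite !ge_min lexx orbT.
  - set rho := Num.min _ _.
    have : rho <= r * ra / (4 * (Ka + 1)) by rewrite /rho !ge_min lexx !orbT.
    have K1 : 0 < 4 * (Ka + 1) by rewrite mulr_gt0 // ltr_wpDl.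
    rewrite ler_pdivlMr // => h.
    rewrite mulrA ler_pdivrMr //.
    have : 0 <= rho by rewrite !le_min !divr_ge0 //= ?mulr_ge0 ?ltW // ltr_wpDl.
    by nra.
have rho00 := ltW rho0.
have sum_al N : \sum_(i < N) `|al i| * rho ^+ i <= r / 2.
  case: N => [|N]; first by rewrite big_ord0 divr_ge0 // ltW.
  rewrite big_ord_recl /= al0 normr0 mul0r add0r.
  apply: (le_trans (ler_norm _)).
  apply: le_trans (@sum_shift_geo _ (fun i => `|al i|) Ka ra rho 1 N ra0 _ _) _.
  - by rewrite ger0_norm.
  - by move=> n; rewrite normr_id.
  - by rewrite expr1 ger0_norm.
have pnorm_trunc N : pnorm rho (trunc N) <= r / 2.
  rewrite (pnormE _ (size_poly _ _)) (le_trans _ (sum_al N)) // ler_sum // => i _.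
  by rewrite coef_poly ltn_ord.
have pnorm_G N : pnorm rho (G N) <= 4 * K.
  apply: (le_trans (pnorm_sum _ _ rho00)).
  apply: (@le_trans _ _ (\sum_(m < N) \sum_(n < N) K * (1 / 2) ^+ m * (1 / 2) ^+ n)).
    apply: ler_sum => m _; apply: (le_trans (pnorm_sum _ _ rho00)); apply: ler_sum => n _.
    have rr0 : 0 <= r / 2 by rewrite divr_ge0 // ltW.
    rewrite pnormZ [X in pnorm _ X]mulrC pnormMXn.
    apply: (@le_trans _ _ `|c m n * (rho ^+ m * (r / 2) ^+ n)|); last first.
      by apply: (term2_le _ _ hc); rewrite ger0_norm.
    rewrite normrM ler_wpM2l // ger0_norm; last by rewrite mulr_ge0 ?exprn_ge0.
    rewrite [X in X <= _]mulrC ler_wpM2l ?exprn_ge0 //.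
    apply: (le_trans (pnormX _ _ rho00)).
    by rewrite lerXn2r ?nnegrE ?pnorm_ge0 // divr_ge0 // ltW.
  under eq_bigr do rewrite -mulr_sumr.
  rewrite -mulr_suml -mulr_sumr.
  have h1 := geo_sum_half N half.
  have h2 : 0 <= \sum_(i < N) (1 / 2 : R) ^+ i by apply: sumr_ge0 => i _; rewrite exprn_ge0 ?divr_ge0.
  rewrite -[X in X <= _]mulrA [X in X <= _]mulrC ler_wpM2r //.
  by rewrite (@le_trans _ _ (2 * 2)) ?ler_pM //; lra.
pose g k := (G k.+1)`_k; exists g, (rho / 2), (4 * K); split.
- by rewrite divr_gt0.
- move=> n; apply: (@le_trans _ _ (`|g n| * rho ^+ n)).
    by rewrite ler_wpM2l // lerXn2r ?nnegrE ?divr_ge0 // ler_pdivrMr //; lra.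
  exact: le_trans (pnorm_coef _ _ rho00) (pnorm_G _).
move=> x hx.
have xrho : `|x| <= rho by apply: (le_trans hx); rewrite ler_pdivrMr //; lra.
have xra : `|x| <= ra by apply: (le_trans xrho); apply: (le_trans rho1); rewrite ler_pdivrMr //; lra.
have xr : `|x| <= r / 2 by apply: (le_trans xrho).
have small N : `|psum1 al x N| <= r / 2.
  apply: (le_trans (ler_norm_sum _ _ _)); apply: le_trans (sum_al N).
  by apply: ler_sum => i _; rewrite normrM normrX ler_wpM2l // lerXn2r ?nnegrE.
have axr : `|a x| <= r / 2.
  rewrite -[a x]subr0; apply: (cvgn_dist_le (N := 0) (hacvg _ xra)) => n _.
  by rewrite subr0.
have GE N : (G N).[x] = psum2 c x (psum1 al x N) N.
  rewrite /G /psum2 horner_sum; apply: eq_bigr => m _; rewrite horner_sum.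
  by apply: eq_bigr => n _; rewrite hornerZ hornerM hornerXn horner_exp horner_poly.
(* Three effects are separated: the coefficients of [G N] from index [N] on, which form a geometric
   tail; the replacement of the truncated inner series by [a x], controlled by the Lipschitz bound;
   and the convergence of the double series at [(x, a x)]. *)
have -> : psum1 g x = (fun N => (psum1 g x N - (G N).[x])
    + ((psum2 c x (psum1 al x N) N - psum2 c x (a x) N) + psum2 c x (a x) N)).
  by apply/funext => N; rewrite GE; ring.
rewrite -[X in _ --> X]add0r; apply: cvgD.
  apply: (@norm_le_cvg0 _ _ (fun N => 2 * (4 * K) * (`|x| / rho) ^+ N)).
    move=> N; rewrite distrC (@horner_coef_wide _ (N + size (G N))) ?leq_addl //.
    rewrite big_split_ord /= (_ : \sum_(i < N) _ = psum1 g x N).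
      rewrite addrAC subrr add0r; apply: sum_shift_geo => // n.
      exact: le_trans (pnorm_coef _ _ rho00) (pnorm_G _).
    by apply: eq_bigr => i _; rewrite comp_trunc_coef.
  rewrite -[X in _ --> X](mulr0 (2 * (4 * K))); apply: cvgM; first exact: cvg_cst.
  apply: cvg_expr; rewrite ger0_norm ?divr_ge0 // ltr_pdivrMr // mul1r.
  by apply: (le_lt_trans hx); rewrite ltr_pdivrMr //; lra.
rewrite -[X in _ --> X]add0r; apply: cvgD; last exact: (psum2_cvg hc).
apply: (@norm_le_cvg0 _ _ (fun N => 2 * (2 * K * (2 / r)) * `|psum1 al x N - a x|)).
  by move=> N; exact: (psum2_lipschitz _ hc).
rewrite -[X in _ --> X](mulr0 (2 * (2 * K * (2 / r)))); apply: cvgM; first exact: cvg_cst.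
rewrite -(normr0 R) -(subrr (a x)); apply: cvg_norm; apply: cvgB; last exact: cvg_cst.
exact: hacvg.
Qed.

End composition.

(** * Integrals over boxes *)

Definition box (R : realType) (d : R) : set (R * R) :=
  [set` `]- d, d[] `*` [set` `]- d, d[].

Lemma boxP (R : realType) (d : R) (z : R * R) :
  box d z <-> `|z.1| < d /\ `|z.2| < d.
Proof. by rewrite /box /setX /= !in_itv /= -!ltr_norml. Qed.

Lemma measurable_box (R : realType) (d : R) : measurable (box d).
Proof. by apply: measurableX; exact: measurable_itv. Qed.

Lemma open_box (R : realType) (d : R) : open (box d).
Proof.
rewrite openE => -[x y] /boxP /= [xd yd].
exists ([set` `]- d, d[], [set` `]- d, d[]) => /=; last by move=> [u v] /=.
by split; apply: open_nbhs_nbhs; split; rewrite ?itv_open //= in_itv /= -ltr_norml.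
Qed.

(** [Lp_loc] takes an arbitrary open [U], while the integral lives on the product sigma-algebra.
    Squares with rational centres and radii [1 / (n + 1)] form a countable family; those not
    contained in [U] are replaced by the empty set. *)
Lemma open_measurable_prod (R : realType) (U : set (R * R)) : open U -> measurable U.
Proof.
move=> oU.
pose B (p q : rat) (e : R) : set (R * R) :=
  [set` `]ratr p - e, ratr p + e[] `*` [set` `]ratr q - e, ratr q + e[].
pose F p q n := if `[< B p q n.+1%:R^-1 `<=` U >] then B p q n.+1%:R^-1 else set0.
have -> : U = \bigcup_p \bigcup_q \bigcup_n F p q n.
  apply/seteqP; split => [[x y] Uxy|z [p _ [q _ [n _]]]]; last first.
    by rewrite /F; case: asboolP => // /[apply].
  have : nbhs (x, y) U by apply: open_nbhs_nbhs.
  move=> -[[A1 A2] [/= /nbhs_ballP[e1 /= e10 A1e] /nbhs_ballP[e2 /= e20 A2e]] AU].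
  have [n [e [eE e0 ee1 ee2]]] : exists n (e : R),
      [/\ n.+1%:R^-1 = e, 0 < e, e + e < e1 & e + e < e2].
    have m0 : 0 < Num.min e1 e2 / 2 by rewrite divr_gt0 // lt_min e10.
    have [n _ hn] := near_infty_natSinv_lt (PosNum m0).
    exists n, n.+1%:R^-1; have := hn n (leqnn _); rewrite /= ltr_pdivlMr //.
    by rewrite mulr_natr mulr2n lt_min => /andP[h1 h2]; split.
  have ratn (z : R) : exists p : rat, `|z - ratr p| < e.
    have [|p] := @rat_in_itvoo R (z - e) (z + e); first by lra.
    by rewrite in_itv /= => /andP[h1 h2]; exists p; rewrite ltr_norml; apply/andP; split; lra.
  have [p hp] := ratn x; have [q hq] := ratn y.
  exists p => //; exists q => //; exists n => //; rewrite /F eE.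
  move: hp hq; rewrite !ltr_norml => /andP[h1 h2] /andP[h3 h4].
  have Bxy : B p q e (x, y).
    by split; rewrite /= in_itv /=; apply/andP; split; lra.
  rewrite asboolT // => -[u v] [/=]; rewrite !in_itv /= => /andP[u1 u2] /andP[v1 v2].
  apply: AU; split => /=; [apply: A1e | apply: A2e]; rewrite /ball /= ltr_norml;
    by apply/andP; split; lra.
do 2 apply: bigcupT_measurable_rat => ?.
apply: bigcupT_measurable => n; rewrite /F; case: ifP => _; last exact: measurable0.
by apply: measurableX; exact: measurable_itv.
Qed.

(** * Dyadic majorants of the singular powers *)

Section dyadic.
Variables (R : realType) (dl : R).
Hypothesis dl01 : 0 < dl < 1.

Let ival (c : R) (n : nat) : set R := [set` `[c - 2 `^ (- n%:R), c + 2 `^ (- n%:R)]].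

Let w (n : nat) : R := 2 `^ ((1 - dl) * n.+1%:R).

(** An integrable majorant of [|y - c|^-(1 - dl)] near [c], made of indicators so that its integral
    is a geometric series. The index [n + 1] in [w n] fits the shell [2^-(n+1) < |y - c| <= 2^-n].
    At [c] itself the sum is infinite, so upper bounds there come for free. *)
Definition dyad (c y : R) : \bar R := (\sum_(0 <= n <oo) (w n * \1_(ival c n) y)%:E)%E.

Let w_ge1 n : 1 <= w n.
Proof.
move: dl01 => /andP[d0 d1]; rewrite -(powRr0 2) /w ler_powR ?ler1n //.
by rewrite mulr_ge0 // subr_ge0 ltW.
Qed.

Let w_ge0 n : 0 <= w n. Proof. exact: le_trans ler01 (w_ge1 n). Qed.

Let term_ge0 c y n : (0 <= (w n * \1_(ival c n) y)%:E)%E.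
Proof. by rewrite lee_fin mulr_ge0. Qed.

Lemma dyad_ge0 c y : (0 <= dyad c y)%E.
Proof. by apply: nneseries_ge0 => n _ _; exact: term_ge0. Qed.

Let term_le_dyad c y n : ((w n * \1_(ival c n) y)%:E <= dyad c y)%E.
Proof.
apply: le_trans (@nneseries_lim_ge _ _ xpredT 0 n.+1 (fun n _ _ => term_ge0 c y n)).
by rewrite big_nat_recr //= leeDr // sume_ge0 // => i _; exact: term_ge0.
Qed.

Let indic_ival c y n : `|y - c| <= 2 `^ (- n%:R) -> \1_(ival c n) y = 1 :> R.
Proof.
move=> h; rewrite indicE mem_set // /ival /= in_itv /=.
by move: h; rewrite ler_norml => /andP[h1 h2]; apply/andP; split; lra.
Qed.

Lemma dyad_ge1 c y : `|y - c| <= 1 -> (1%:E <= dyad c y)%E.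
Proof.
move=> h; apply: le_trans (term_le_dyad c y 0); rewrite lee_fin indic_ival ?mulr1 //.
by rewrite oppr0 powRr0.
Qed.

Lemma dyad_center c : dyad c c = +oo%E.
Proof.
apply/eqyP => A A0; pose N := (Num.bound A).
apply: le_trans (@nneseries_lim_ge _ _ xpredT 0 N (fun n _ _ => term_ge0 c c n)).
rewrite sumEFin lee_fin; apply: (@le_trans _ _ (\sum_(0 <= i < N) 1)).
  rewrite big_const_nat subn0 iter_addr_0.
  by apply: ltW; have := archi_boundP (ltW A0).
apply: ler_sum => n _; rewrite indic_ival ?mulr1 // subrr normr0 powR_ge0 //.
Qed.

Lemma powR_le_dyad c y : y != c -> `|y - c| <= 1 ->
  ((`|y - c| `^ (- (1 - dl)))%:E <= dyad c y)%E.
Proof.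
move=> yc y1; set z := `|y - c|; have z0 : 0 < z by rewrite normr_gt0 subr_eq0.
have ex : exists n, 2 `^ (- n.+1%:R) < z.
  have [n _ hn] := near_infty_natSinv_lt (PosNum z0).
  exists n; apply: le_lt_trans (hn n (leqnn _)); rewrite /= powRN lef_pV2 ?posrE ?powR_gt0 //.
  by rewrite powR_mulrn // -natrX ler_nat ltnW // ltn_expl.
(* Minimality of [n] locates [z] in a dyadic shell; for [n = 0] the upper end is the hypothesis
   [|y - c| <= 1]. *)
pose n := ex_minn ex; have [hn zn] : 2 `^ (- n.+1%:R) < z /\ z <= 2 `^ (- n%:R).
  rewrite /n; case: ex_minnP => -[|m] hm min; split => //.
    by rewrite oppr0 powRr0.
  by rewrite leNgt; apply/negP => /min; rewrite ltnn.
apply: le_trans (term_le_dyad c y n); rewrite lee_fin indic_ival // mulr1 /w.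
have -> : (1 - dl) * n.+1%:R = - n.+1%:R * - (1 - dl) by ring.
move: dl01 => /andP[d0 d1].
rewrite powRrM !(powRN _ (1 - dl)) lef_pV2 ?posrE ?powR_gt0 //.
by apply: ge0_ler_powR; rewrite ?nnegrE ?subr_ge0 ?powR_ge0 ?ltW.
Qed.

Let measurable_term c n : measurable_fun [set: R] (fun y => (w n * \1_(ival c n) y)%:E).
Proof.
apply/measurable_EFinP; apply: measurable_funM; first exact: measurable_cst.
by apply: measurable_indic; exact: measurable_itv.
Qed.

Lemma measurable_dyad c : measurable_fun [set: R] (dyad c).
Proof.
apply: (@ge0_emeasurable_sum _ _ _ _ (fun n y => (w n * \1_(ival c n) y)%:E) xpredT).
  by move=> k x _ _; exact: term_ge0.
by move=> k _; exact: measurable_term.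
Qed.

Lemma integral_dyad_le : exists K : R, 0 <= K /\
  forall c, (\int[lebesgue_measure]_y dyad c y <= K%:E)%E.
Proof.
(* The [n]-th term integrates to [2^((1 - dl)(n + 1))] times the length [2 * 2^-n], that is
   [b * th ^+ n]. The centre does not enter, so the bound is uniform in [c]. *)
pose th : R := 2 `^ (- dl); pose b : R := 2 `^ (1 - dl) * 2.
move: dl01 => /andP[d0 d1].
have th1 : th < 1.
  have := @gt0_ltr_powR R dl d0 1 2; rewrite powR1 !nnegrE => /(_ ler01 (ler0n _ _)).
  by rewrite /th powRN invf_lt1 ?powR_gt0 //; apply; rewrite ltr1n.
have th0 : 0 < th by rewrite powR_gt0.
have b0 : 0 <= b by rewrite mulr_ge0 ?powR_ge0.
exists (b / (1 - th)); split; first by rewrite divr_ge0 // subr_ge0 ltW.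
move=> c; rewrite /dyad integral_nneseries //; last by move=> n; exact: measurable_term.
have E n : (\int[lebesgue_measure]_y (w n * \1_(ival c n) y)%:E = (b * th ^+ n)%:E)%E.
  under eq_integral do rewrite EFinM.
  rewrite ge0_integralZl //; last 2 first.
  - by apply/measurable_EFinP; apply: measurable_indic; exact: measurable_itv.
  - by rewrite lee_fin.
  rewrite integral_indic //; last exact: measurable_itv.
  rewrite setIT /ival /= lebesgue_measure_itv /= lte_fin.
  have p0 : 0 < 2 `^ (- n%:R) :> R by rewrite powR_gt0.
  rewrite ifT; last by lra.
  rewrite -EFinD -EFinM; congr (_%:E).
  rewrite /w /b /th (_ : (1 - dl) * n.+1%:R = (1 - dl) * n%:R + (1 - dl)); last by rewrite -natr1; ring.
  rewrite powRD; last by rewrite pnatr_eq0 implybT.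
  rewrite -[_ ^+ n]powR_mulrn ?powR_ge0 // -powRrM.
  rewrite (_ : - dl * n%:R = (1 - dl) * n%:R + - n%:R); last by ring.
  rewrite (@powRD _ _ ((1 - dl) * n%:R) (- n%:R)); last by rewrite pnatr_eq0 implybT.
  by ring.
under eq_eseriesr do rewrite E.
apply: lime_le; first by apply: is_cvg_nneseries => n _ _; rewrite lee_fin mulr_ge0 // exprn_ge0 // ltW.
near=> n; rewrite sumEFin lee_fin big_mkord -mulr_sumr ler_wpM2l //.
rewrite -[X in _ <= X]mul1r ler_pdivlMr ?subr_gt0 //.
have -> : (\sum_(i < n) th ^+ i) * (1 - th) = 1 - th ^+ n.
  by rewrite -[RHS]opprB subrX1; ring.
by rewrite gerBl exprn_ge0 // ltW.
Unshelve. all: by end_near. Qed.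

End dyadic.

Lemma integral_box_tonelli (R : realType) (d : R) (F : R * R -> R) :
  measurable_fun (box d) F -> (forall z, 0 <= F z) ->
  measurable_fun [set: R] (fubini_F (@lebesgue_measure R) ((EFin \o F) \_ (box d))) /\
  (\int[(@lebesgue_measure R) \x (@lebesgue_measure R)]_(z in box d) (F z)%:E =
   \int[@lebesgue_measure R]_x fubini_F (@lebesgue_measure R) ((EFin \o F) \_ (box d)) x)%E.
Proof.
move=> mF F0.
have mFb : measurable_fun [set: R * R] ((EFin \o F) \_ (box d)).
  apply/(measurable_restrict (EFin \o F) (measurable_box d) measurableT).
  by rewrite setTI; apply/measurable_EFinP.
have Fb0 z : (0 <= ((EFin \o F) \_ (box d)) z)%E.
  by rewrite patchE; case: ifP => // _; rewrite lee_fin.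
split; first exact: measurable_fun_fubini_tonelli_F.
by rewrite integral_mkcond fubini_tonelli1.
Qed.

Lemma measurable_patch_section (R : realType) (d : R) (F : R * R -> R) (x : R) :
  measurable_fun (box d) F ->
  measurable_fun [set: R] (fun y => ((EFin \o F) \_ (box d)) (x, y)).
Proof.
move=> mF; have mFb : measurable_fun [set: R * R] ((EFin \o F) \_ (box d)).
  apply/(measurable_restrict (EFin \o F) (measurable_box d) measurableT).
  by rewrite setTI; apply/measurable_EFinP.
exact: (measurableT_comp mFb (measurable_pair1 x)).
Qed.

(** The bound on [F] is requested only off [x = 0] and off the branches. On these exceptional sets
    the dyadic majorant is infinite, so the comparison holds at every point and no null set has to
    be removed before applying Tonelli. *)
Lemma integral_box_lty (R : realType) (d dl C : R) (M : nat) (a : 'I_M -> R -> R)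
    (F : R * R -> R) :
  0 < dl < 1 -> d <= 1 / 2 -> 0 < C -> measurable_fun (box d) F -> (forall z, 0 <= F z) ->
  (forall j x, `|x| < d -> `|a j x| <= 1 / 2) ->
  (forall x y, `|x| < d -> `|y| < d -> x != 0 -> (forall j, y != a j x) ->
     F (x, y) <= C * `|x| `^ (- (1 - dl)) * (1 + \sum_(j < M) `|y - a j x| `^ (- (1 - dl)))) ->
  (\int[(@lebesgue_measure R) \x (@lebesgue_measure R)]_(z in box d) (F z)%:E < +oo)%E.
Proof.
move=> dl01 d1 C0 mF F0 ha hF.
have [K [K0 hK]] := integral_dyad_le dl01.
have [mF1 ->] := integral_box_tonelli mF F0.
(* The summand [dyad dl 0 y] stands for the constant 1 of the bound: it is at least 1 for
   [|y| <= 1], and its integral over the whole line is finite. *)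
pose D x y : \bar R := (dyad dl 0 y + \sum_(j < M) dyad dl (a j x) y)%E.
have sum0 x y : (0 <= \sum_(j < M) dyad dl (a j x) y)%E.
  by apply: sume_ge0 => j _; exact: dyad_ge0.
have D0 x y : (0 <= D x y)%E by rewrite adde_ge0 // dyad_ge0.
have pointwise x y : (((EFin \o F) \_ (box d)) (x, y) <= C%:E * dyad dl 0 x * D x y)%E.
  have R0 : (0 <= C%:E * dyad dl 0 x * D x y)%E.
    by rewrite mule_ge0 // mule_ge0 ?lee_fin ?(ltW C0) // dyad_ge0.
  rewrite patchE; case: ifP => // /set_mem /boxP /= [xd yd].
  have x1 : `|x - 0| <= 1 by rewrite subr0; lra.
  have y1 : `|y - 0| <= 1 by rewrite subr0; lra.
  have Dge1 : (1 <= D x y)%E by rewrite -[1%E]adde0 leeD // dyad_ge1.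
  have Dgt0 : (0 < D x y)%E by apply: lt_le_trans Dge1.
  have [x0|x0] := eqVneq x 0.
    have -> : dyad dl 0 x = +oo%E by rewrite x0 (dyad_center dl01).
    by rewrite gt0_muley ?lte_fin // gt0_mulye ?leey.
  have xge1 := dyad_ge1 dl01 x1.
  have xgt0 : (0 < dyad dl 0 x)%E by apply: lt_le_trans xge1.
  have ya1 j : `|y - a j x| <= 1.
    by apply: (le_trans (ler_normB _ _)); have := ha j x xd; lra.
  have [/existsP[j /eqP yj]|/existsPn ya] := boolP [exists j, y == a j x].
    have -> : D x y = +oo%E.
      apply/eqP; rewrite -leye_eq /D (bigD1 j) //= yj (dyad_center dl01).
      rewrite addye ?addey ?leey //; rewrite -ltNye; apply: lt_le_trans (ltNyr 0) _.
        exact: dyad_ge0.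
      by apply: sume_ge0 => i _; exact: dyad_ge0.
    by rewrite gt0_muley ?leey // mule_gt0 // lte_fin.
  apply: (@le_trans _ _ (C * `|x| `^ (- (1 - dl)) *
      (1 + \sum_(j < M) `|y - a j x| `^ (- (1 - dl))))%:E).
    by rewrite lee_fin; apply: hF.
  rewrite !EFinM; apply: lee_pmul.
  - by rewrite mule_ge0 ?lee_fin ?powR_ge0 // ltW.
  - by rewrite lee_fin addr_ge0 // sumr_ge0 // => j _; rewrite powR_ge0.
  - apply: lee_pmul; rewrite ?lee_fin ?(ltW C0) ?powR_ge0 //.
    by have := powR_le_dyad dl01 x0 x1; rewrite subr0.
  - rewrite EFinD leeD ?dyad_ge1 // -sumEFin; apply: lee_sum => j _.
    exact: powR_le_dyad.
have mD x : measurable_fun [set: R] (D x).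
  apply: emeasurable_funD; first exact: measurable_dyad.
  by apply: emeasurable_sum => j; exact: measurable_dyad.
have intD x : (\int[lebesgue_measure]_y D x y <= (K * M.+1%:R)%:E)%E.
  rewrite ge0_integralD //; last 3 first.
  - by move=> y _; exact: dyad_ge0.
  - exact: measurable_dyad.
  - by apply: emeasurable_sum => j; exact: measurable_dyad.
  rewrite ge0_integral_sum //; last 2 first.
  - by move=> j; exact: measurable_dyad.
  - by move=> j y _; exact: dyad_ge0.
  rewrite mulrSr mulrDr mulr1 addrC EFinD leeD //.
  apply: (@le_trans _ _ (\sum_(j < M) K%:E)%E); first by apply: lee_sum.
  by rewrite sumEFin lee_fin sumr_const card_ord mulr_natr.
apply: (@le_lt_trans _ _ (\int[lebesgue_measure]_x ((C * (K * M.+1%:R))%:E * dyad dl 0 x))%E).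
  apply: ge0_le_integral => //.
  - by move=> x _; apply: integral_ge0 => y _; rewrite patchE; case: ifP; rewrite ?lee_fin.
  - by apply: measurable_funeM; exact: measurable_dyad.
  move=> x _; apply: (@le_trans _ _ (\int[lebesgue_measure]_y (C%:E * dyad dl 0 x * D x y))%E).
    apply: ge0_le_integral => //.
    - by move=> y _; rewrite patchE; case: ifP; rewrite ?lee_fin.
    - exact: measurable_patch_section.
    - exact: (measurable_funeM (C%:E * dyad dl 0 x)%E (mD x)).
  rewrite ge0_integralZl //; last 2 first.
  - exact: mD.
  - by rewrite mule_ge0 ?lee_fin ?(ltW C0) // dyad_ge0.
  rewrite EFinM [X in (_ <= X)%E]muleAC; apply: lee_pmul => //.
    by rewrite mule_ge0 ?lee_fin ?(ltW C0) // dyad_ge0.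
  by apply: integral_ge0.
rewrite ge0_integralZl //; last 3 first.
- exact: measurable_dyad.
- by move=> x _; exact: dyad_ge0.
- by rewrite lee_fin !mulr_ge0 // ltW.
apply: (@le_lt_trans _ _ ((C * (K * M.+1%:R))%:E * K%:E)%E); last by rewrite -EFinM ltry.
by rewrite lee_wpmul2l // lee_fin !mulr_ge0 // ltW.
Qed.

Lemma dyadic_sum_le_inv (R : realType) (d x : R) (N : nat) : 0 < d -> 0 < x ->
  \sum_(n < N) 2 ^+ n / d * \1_([set` `]0, (d / 2 ^+ n)[]) x <= 2 / x.
Proof.
move=> d0 x0.
(* The second bound is what the induction needs: when [x] lies in the next interval, both the sum so
   far and the new term are at most [2 ^+ N / d], which is below [1 / x]. *)
suff [] : \sum_(n < N) 2 ^+ n / d * \1_([set` `]0, (d / 2 ^+ n)[]) x <= 2 / x /\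
          \sum_(n < N) 2 ^+ n / d * \1_([set` `]0, (d / 2 ^+ n)[]) x <= 2 ^+ N / d by [].
elim: N => [|N [IH1 IH2]].
  by rewrite big_ord0 !divr_ge0 ?exprn_ge0 // ltW.
rewrite big_ord_recr /=; set S := \sum_(n < N) _ in IH1 IH2 *.
have p0 : 0 < 2 ^+ N / d by rewrite divr_gt0 // exprn_gt0.
rewrite indicE exprS -mulrA; case: (boolP (x \in _)) => /=; rewrite ?mulr1 ?mulr0 ?addr0; last first.
  by move=> _; split => //; lra.
rewrite inE /= in_itv /= x0 /= => xN; split; last by lra.
have h : 2 ^+ N / d < 1 / x.
  rewrite ltr_pdivrMr // mulrAC ltr_pdivlMr // mul1r mulrC -ltr_pdivlMr ?exprn_gt0 //.
by lra.
Qed.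

(* The sections contribute at least kap / x, and the integral of 1 / x diverges
   at 0 because every dyadic scale has the same weight. *)
Lemma integral_box_infty (R : realType) (d d' kap : R) (F : R * R -> R) :
  0 < kap -> 0 < d' -> d' <= d -> measurable_fun (box d) F -> (forall z, 0 <= F z) ->
  (forall x : R, 0 < x < d' -> exists l w B : R, [/\ 0 < w, 0 <= B, kap / x <= B * w &
     forall y, l <= y <= l + w -> `|y| < d /\ B <= F (x, y)]) ->
  (\int[(@lebesgue_measure R) \x (@lebesgue_measure R)]_(z in box d) (F z)%:E = +oo)%E.
Proof.
move=> kap0 d'0 d'd mF F0 hF; have [mF1 ->] := integral_box_tonelli mF F0.
set Phi := fubini_F _ _ in mF1 *.
have mI (i : interval R) : measurable_fun [set: R] (fun y => (\1_([set` i]) y)%:E).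
  by apply/measurable_EFinP; apply: measurable_indic; exact: measurable_itv.
have Phi0 x : (0 <= Phi x)%E.
  by apply: integral_ge0 => y _; rewrite patchE; case: ifP; rewrite ?lee_fin.
have hPhi x : 0 < x < d' -> ((kap / x)%:E <= Phi x)%E.
  move=> /[dup] /andP[x0 xd'] /hF [l [w [B [w0 B0 hB hFB]]]].
  apply: (@le_trans _ _ (\int[lebesgue_measure]_y (B * \1_([set` `[l, (l + w)]]) y)%:E)%E).
    under eq_integral do rewrite EFinM.
    rewrite ge0_integralZl //; last exact: mI.
    rewrite integral_indic //.
    rewrite setIT /= lebesgue_measure_itv /= lte_fin ltrDl w0 -EFinD -EFinM lee_fin.
    by rewrite addrAC subrr add0r.
  apply: ge0_le_integral => //.
  - by move=> y _; rewrite lee_fin mulr_ge0.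
  - apply/measurable_EFinP; apply: measurable_funM; first exact: measurable_cst.
    by apply: measurable_indic; exact: measurable_itv.
  - exact: measurable_patch_section.
  move=> y _; rewrite indicE; case: (boolP (y \in _)); rewrite ?mulr0 ?mulr1; last first.
    by move=> _; rewrite patchE; case: ifP; rewrite ?lee_fin.
  rewrite inE /= in_itv /= => /hFB [yd BF].
  rewrite patchE mem_set ?lee_fin //; apply/boxP; split => //=.
  by rewrite ger0_norm ?(ltW x0) // (lt_le_trans xd').
have hN N : (((kap / 2) * N%:R)%:E <= \int[lebesgue_measure]_x Phi x)%E.
  (* Height [2 ^+ n / d'] on an interval of length [d' / 2 ^+ n] has integral 1 at every scale; the
     factor [kap / 2] absorbs the 2 of [dyadic_sum_le_inv], so any number of scales fits below
     [kap / x]. *)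
  pose T n (x : R) : \bar R := (kap / 2 * (2 ^+ n / d' * \1_([set` `]0, (d' / 2 ^+ n)[]) x))%:E.
  have T0 n x : (0 <= T n x)%E.
    by rewrite lee_fin !mulr_ge0 ?invr_ge0 ?exprn_ge0 // ltW.
  have mT n : measurable_fun [set: R] (T n).
    apply/measurable_EFinP; apply: measurable_funM; first exact: measurable_cst.
    apply: measurable_funM; first exact: measurable_cst.
    by apply: measurable_indic; exact: measurable_itv.
  have intT n : (\int[lebesgue_measure]_x T n x = (kap / 2)%:E)%E.
    rewrite /T; under eq_integral do rewrite mulrA EFinM.
    rewrite ge0_integralZl //; last 2 first.
    - exact: mI.
    - by rewrite lee_fin !mulr_ge0 ?invr_ge0 ?exprn_ge0 // ltW.
    rewrite integral_indic //.
    rewrite setIT /= lebesgue_measure_itv /= lte_fin divr_gt0 ?exprn_gt0 //.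
    rewrite -EFinD -EFinM subr0; congr (_%:E).
    by field; rewrite ?expf_neq0 ?gt_eqF // exprn_gt0.
  apply: (@le_trans _ _ (\int[lebesgue_measure]_x (\sum_(n < N) T n x))%E).
    rewrite ge0_integral_sum //; last by move=> n; exact: mT.
    under eq_bigr do rewrite intT.
    by rewrite sumEFin lee_fin sumr_const card_ord mulr_natr.
  apply: ge0_le_integral => //.
  - by move=> x _; apply: sume_ge0.
  - by apply: emeasurable_sum => n; exact: mT.
  move=> x _; case: (boolP (0 < x < d')) => [xd|xd].
    apply: le_trans (hPhi _ xd); move: xd => /andP[x0 _].
    rewrite sumEFin lee_fin -mulr_sumr.
    have k2 : 0 <= kap / 2 by rewrite divr_ge0 // ltW.
    apply: le_trans (ler_wpM2l k2 (dyadic_sum_le_inv N d'0 x0)) _.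
    by rewrite le_eqVlt; apply/orP; left; apply/eqP; field; rewrite gt_eqF.
  rewrite big1 // => n _; rewrite /T indicE memNset ?mulr0 //= in_itv /= => /andP[x0 xn].
  move: xd; rewrite x0 /= -leNgt => d'x; move: (le_lt_trans d'x xn).
  by rewrite ltr_pdivlMr ?exprn_gt0 // gtr_pMr // ltNge exprn_ege1 // ler1n.
apply/eqyP => A A0; have [N hA] : exists N : nat, A <= kap / 2 * N%:R.
  exists (Num.bound (A / (kap / 2))).
  have k2 : 0 < kap / 2 by rewrite divr_gt0.
  rewrite mulrC -ler_pdivrMr // ltW //.
  by apply: archi_boundP; rewrite divr_ge0 // ltW.
by apply: le_trans (hN N); rewrite lee_fin.
Qed.

(** * Complex-valued functions *)

Section complex_parts.
Variable R : realType.
Local Notation C := (R[i]).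

Lemma cmodE (z : C) : cmod z = Normc.normc z.
Proof. by case: z. Qed.

Lemma cmodM (z w : C) : cmod (z * w) = cmod z * cmod w.
Proof. by rewrite !cmodE Normc.normcM. Qed.

Lemma cmodV (z : C) : cmod z^-1 = (cmod z)^-1.
Proof. by rewrite !cmodE Normc.normcV. Qed.

Lemma cmod_ge0 (z : C) : 0 <= cmod z.
Proof. exact: sqrtr_ge0. Qed.

Lemma cmod_prod (I : Type) (s : seq I) (P : pred I) (f : I -> C) :
  cmod (\prod_(i <- s | P i) f i) = \prod_(i <- s | P i) cmod (f i).
Proof.
by apply: (big_morph _ cmodM); rewrite cmodE Normc.normc1.
Qed.

Lemma Re_le_cmod (z : C) : `|complex.Re z| <= cmod z.
Proof. by rewrite -sqrtr_sqr ler_sqrt ?lerDl ?addr_ge0 ?sqr_ge0. Qed.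

Lemma Im_le_cmod (z : C) : `|complex.Im z| <= cmod z.
Proof. by rewrite -sqrtr_sqr ler_sqrt ?lerDr ?addr_ge0 ?sqr_ge0. Qed.

Lemma cmod_le_ReIm (z : C) : cmod z <= `|complex.Re z| + `|complex.Im z|.
Proof.
rewrite -[X in _ <= X]ger0_norm ?addr_ge0 // -sqrtr_sqr ler_sqrt ?sqr_ge0 //.
rewrite sqrrD !real_normK ?num_real // lerD2r lerDl mulrn_wge0 // mulr_ge0 //.
Qed.

Lemma complexRe_sum (I : Type) (s : seq I) (P : pred I) (f : I -> C) :
  complex.Re (\sum_(i <- s | P i) f i) = \sum_(i <- s | P i) complex.Re (f i).
Proof. by apply: (big_morph (@complex.Re R)) => // -[a b] [c d]. Qed.

Lemma complexIm_sum (I : Type) (s : seq I) (P : pred I) (f : I -> C) :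
  complex.Im (\sum_(i <- s | P i) f i) = \sum_(i <- s | P i) complex.Im (f i).
Proof. by apply: (big_morph (@complex.Im R)) => // -[a b] [c d]. Qed.

Lemma complexReMr (z : C) (r : R) : complex.Re (z * RtoC r) = complex.Re z * r.
Proof. by case: z => a b /=; rewrite mulr0 subr0. Qed.

Lemma complexImMr (z : C) (r : R) : complex.Im (z * RtoC r) = complex.Im z * r.
Proof. by case: z => a b /=; rewrite mulr0 add0r. Qed.

(** At real points the parts of the sum are the sums of the parts, which lets the real interpolation
    and composition results act on each component. *)
Lemma evalC2E (c : nat -> nat -> C) (x y : R) : evalC2 c x y =
  Complex (evalR2 (fun m n => complex.Re (c m n)) x y)
          (evalR2 (fun m n => complex.Im (c m n)) x y).
Proof.
congr Complex; congr (lim (_ @ \oo)); apply/funext => N.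
  rewrite complexRe_sum; apply: eq_bigr => m _; rewrite complexRe_sum.
  by apply: eq_bigr => n _; rewrite complexReMr.
rewrite complexIm_sum; apply: eq_bigr => m _; rewrite complexIm_sum.
by apply: eq_bigr => n _; rewrite complexImMr.
Qed.

Lemma evalC1E (c : nat -> C) (x : R) : evalC1 c x =
  Complex (evalR1 (fun n => complex.Re (c n)) x) (evalR1 (fun n => complex.Im (c n)) x).
Proof.
congr Complex; congr (lim (_ @ \oo)); apply/funext => N.
  by rewrite complexRe_sum; apply: eq_bigr => n _; rewrite complexReMr.
by rewrite complexIm_sum; apply: eq_bigr => n _; rewrite complexImMr.
Qed.

Lemma conv_series2_parts (c : nat -> nat -> C) : conv_series2 c -> exists r K : R,
  coef2_le (fun m n => complex.Re (c m n)) r K /\ coef2_le (fun m n => complex.Im (c m n)) r K.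
Proof.
move=> [r [r0 [K hc]]]; exists r, K; split; split => // m n.
  by apply: le_trans (hc m n); rewrite ler_wpM2r ?Re_le_cmod // exprn_ge0 // ltW.
by apply: le_trans (hc m n); rewrite ler_wpM2r ?Im_le_cmod // exprn_ge0 // ltW.
Qed.

Lemma ord_ge_bound (g : R -> C) (k : nat) : ord_ge g k ->
  exists d K : R, [/\ 0 < d, 0 <= K & forall x, `|x| <= d -> cmod (g x) <= K * `|x| ^+ k].
Proof.
move=> [h [[r [r0 [K hK]]] [d [d0 gE]]]].
have c1 : conv_series1R (fun n => complex.Re (h n)).
  exists r; split => //; exists K => n; apply: le_trans (hK n).
  by rewrite ler_wpM2r ?Re_le_cmod // exprn_ge0 // ltW.
have c2 : conv_series1R (fun n => complex.Im (h n)).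
  exists r; split => //; exists K => n; apply: le_trans (hK n).
  by rewrite ler_wpM2r ?Im_le_cmod // exprn_ge0 // ltW.
have [r1 [K1 [r10 K10 h1]]] := is_ps_taylor 0 (is_ps_evalR1 c1).
have [r2 [K2 [r20 K20 h2]]] := is_ps_taylor 0 (is_ps_evalR1 c2).
exists (Num.min (d / 2) (Num.min r1 r2)), (K1 + K2); split.
- by rewrite !lt_min r10 r20 divr_gt0.
- exact: addr_ge0.
move=> x; rewrite !le_min => /and3P[xd x1 x2].
rewrite gE; last by apply: le_lt_trans xd _; rewrite ltr_pdivrMr //; lra.
have -> : cmod (RtoC (x ^+ k) * evalC1 h x) = `|x| ^+ k * cmod (evalC1 h x).
  by rewrite cmodM /cmod /= expr0n addr0 sqrtr_sqr normrX.
rewrite mulrC ler_wpM2r ?exprn_ge0 // (le_trans (cmod_le_ReIm _)) // evalC1E /=.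
have := h1 x x1; have := h2 x x2; rewrite /psum1 !big_ord0 !subr0 !expr0 !mulr1 => e2 e1.
exact: lerD.
Qed.

Lemma ord_ge_parts (g1 g2 : R -> R) (c1 c2 : nat -> R) (k : nat) :
  is_ps g1 c1 -> is_ps g2 c2 -> (forall n, (n < k)%N -> c1 n = 0) ->
  (forall n, (n < k)%N -> c2 n = 0) -> ord_ge (fun x => Complex (g1 x) (g2 x)) k.
Proof.
move=> p1 p2 z1 z2.
have [h1 [[r1 [r10 [K1 hK1]]] [d1 [d10 e1]]]] := is_ps_ord p1 z1.
have [h2 [[r2 [r20 [K2 hK2]]] [d2 [d20 e2]]]] := is_ps_ord p2 z2.
exists (fun n => Complex (h1 n) (h2 n)); split.
  exists (Num.min r1 r2); split; first by rewrite lt_min r10.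
  have m0 : 0 <= Num.min r1 r2 by rewrite le_min !ltW.
  exists (K1 + K2) => n.
  apply: (@le_trans _ _ ((`|h1 n| + `|h2 n|) * Num.min r1 r2 ^+ n)).
    by rewrite ler_wpM2r ?exprn_ge0 // (le_trans (cmod_le_ReIm _)).
  rewrite mulrDl lerD //.
    apply: le_trans (hK1 n); rewrite ler_wpM2l // lerXn2r ?nnegrE ?(ltW r10) //.
    by rewrite ge_min lexx.
  apply: le_trans (hK2 n); rewrite ler_wpM2l // lerXn2r ?nnegrE ?(ltW r20) //.
  by rewrite ge_min lexx orbT.
exists (Num.min d1 d2); split; first by rewrite lt_min d10.
move=> x; rewrite lt_min => /andP[x1 x2].
rewrite (e1 _ x1) (e2 _ x2) evalC1E /RtoC; apply/eqP; rewrite eq_complex /=.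
by rewrite !mul0r subr0 addr0 !eqxx.
Qed.

(** * Measurability of complex-valued functions *)

Definition cmeasurable_fun (d : measure_display) (T : measurableType d) (D : set T) (f : T -> C) :=
  measurable_fun D (fun z => complex.Re (f z)) /\ measurable_fun D (fun z => complex.Im (f z)).

Lemma cmeasurable_funM (d : measure_display) (T : measurableType d) (D : set T) (f g : T -> C) :
  cmeasurable_fun D f -> cmeasurable_fun D g -> cmeasurable_fun D (fun z => f z * g z).
Proof.
move=> [f1 f2] [g1 g2]; split.
  have -> : (fun z => complex.Re (f z * g z)) =
     (fun z => complex.Re (f z) * complex.Re (g z) - complex.Im (f z) * complex.Im (g z)).
    by apply/funext => z; case: (f z) => a b; case: (g z).
  by apply: measurable_funB; apply: measurable_funM.
have -> : (fun z => complex.Im (f z * g z)) =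
   (fun z => complex.Re (f z) * complex.Im (g z) + complex.Im (f z) * complex.Re (g z)).
  by apply/funext => z; case: (f z) => a b; case: (g z).
by apply: measurable_funD; apply: measurable_funM.
Qed.

Lemma cmeasurable_prod (d : measure_display) (T : measurableType d) (D : set T)
    (I : Type) (s : seq I) (f : I -> T -> C) :
  (forall i, cmeasurable_fun D (f i)) -> cmeasurable_fun D (fun z => \prod_(i <- s) f i z).
Proof.
move=> mf; elim: s => [|i s IH].
  by split; under eq_fun do rewrite big_nil; exact: measurable_cst.
split; under eq_fun do rewrite big_cons.
  exact: (cmeasurable_funM (mf i) IH).1.
exact: (cmeasurable_funM (mf i) IH).2.
Qed.

Lemma measurable_cmod_sqr (d : measure_display) (T : measurableType d) (D : set T) (f : T -> C) :
  cmeasurable_fun D f ->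
  measurable_fun D (fun z => complex.Re (f z) ^+ 2 + complex.Im (f z) ^+ 2).
Proof. by move=> [f1 f2]; apply: measurable_funD; apply: measurable_funX. Qed.

Lemma cmeasurable_funV (d : measure_display) (T : measurableType d) (D : set T) (f : T -> C) :
  cmeasurable_fun D f -> cmeasurable_fun D (fun z => (f z)^-1).
Proof.
move=> mf; have [f1 f2] := mf.
(* Real powers are measurable, and the power [-1] agrees with the inverse on nonnegative numbers,
   including 0, where both are 0 by convention. *)
have mV : measurable_fun D (fun z => (complex.Re (f z) ^+ 2 + complex.Im (f z) ^+ 2)^-1).
  under eq_fun => z do rewrite -powR_inv1 ?addr_ge0 ?sqr_ge0 //.
  exact: (measurableT_comp (measurable_powR (-1)) (measurable_cmod_sqr mf)).
split.
  have -> : (fun z => complex.Re (f z)^-1) =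
    (fun z => complex.Re (f z) * (complex.Re (f z) ^+ 2 + complex.Im (f z) ^+ 2)^-1).
    by apply/funext => z; case: (f z).
  exact: measurable_funM.
have -> : (fun z => complex.Im (f z)^-1) =
  (fun z => - (complex.Im (f z) * (complex.Re (f z) ^+ 2 + complex.Im (f z) ^+ 2)^-1)).
  by apply/funext => z; case: (f z).
by apply: measurable_funN; exact: measurable_funM.
Qed.

Lemma measurable_cmod_powR (d : measure_display) (T : measurableType d) (D : set T)
    (f : T -> C) (p : R) :
  cmeasurable_fun D f -> measurable_fun D (fun z => cmod (f z) `^ p).
Proof.
move=> mf; apply: (measurableT_comp (measurable_powR p)).
rewrite /cmod; under eq_fun => z do rewrite -powR12_sqrt ?addr_ge0 ?sqr_ge0 //.
exact: (measurableT_comp (measurable_powR 2^-1) (measurable_cmod_sqr mf)).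
Qed.

Lemma cmeasurable_Pprod (M : nat) (L : 'I_M -> nat) (q : 'I_M -> {poly R}) (D : set (R * R)) :
  cmeasurable_fun D (fun z => Pprod L q z.1 z.2).
Proof.
apply: cmeasurable_prod => j.
have m1 : measurable_fun D (fun z : R * R => z.1) by apply: measurable_funTS; exact: measurable_fst.
have m2 : measurable_fun D (fun z : R * R => z.2) by apply: measurable_funTS; exact: measurable_snd.
split.
  have -> : (fun z : R * R => complex.Re (RtoC (z.2 + (q j).[z.1]) +
      Complex 0 1 * RtoC (z.1 ^+ (2 * L j)))) =
    (fun z => z.2 + \sum_(i < size (q j)) (q j)`_i * z.1 ^+ i).
    by apply/funext => z /=; rewrite horner_coef mul0r mulr0 subr0 addr0.
  apply: measurable_funD => //; apply: measurable_sum => i.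
  by apply: measurable_funM; [exact: measurable_cst | exact: measurable_funX].
have -> : (fun z : R * R => complex.Im (RtoC (z.2 + (q j).[z.1]) +
      Complex 0 1 * RtoC (z.1 ^+ (2 * L j)))) = (fun z => z.1 ^+ (2 * L j)).
  by apply/funext => z /=; rewrite mul1r mul0r !add0r.
exact: measurable_funX.
Qed.

Lemma measurable_evalR2 (c : nat -> nat -> R) (r K d : R) : coef2_le c r K -> d <= r / 2 ->
  measurable_fun (box d) (fun z => evalR2 c z.1 z.2).
Proof.
move=> hc dr; apply: (@measurable_fun_cvg _ _ _ _ (fun N z => psum2 c z.1 z.2 N)).
  have m1 : measurable_fun (box d) (fun z : R * R => z.1) by apply: measurable_funTS; exact: measurable_fst.
  have m2 : measurable_fun (box d) (fun z : R * R => z.2) by apply: measurable_funTS; exact: measurable_snd.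
  move=> N; apply: measurable_sum => m; apply: measurable_sum => n.
  apply: measurable_funM; first exact: measurable_cst.
  by apply: measurable_funM; apply: measurable_funX.
move=> z /boxP[z1 z2]; apply: (psum2_cvg hc); exact: le_trans (ltW _) dr.
Qed.

Lemma cmeasurable_evalC2 (c : nat -> nat -> C) (r K d : R) :
  coef2_le (fun m n => complex.Re (c m n)) r K -> coef2_le (fun m n => complex.Im (c m n)) r K ->
  d <= r / 2 -> cmeasurable_fun (box d) (fun z => evalC2 c z.1 z.2).
Proof.
move=> h1 h2 dr; split; under eq_fun do rewrite evalC2E /=;
  [exact: (measurable_evalR2 h1 dr) | exact: (measurable_evalR2 h2 dr)].
Qed.

End complex_parts.

(** * Exact order and lower bounds near a branch *)

Lemma fin_radius (R : realType) (I : finType) (P : I -> R -> Prop) :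
  (forall i, exists d : R, 0 < d /\ forall x, `|x| <= d -> P i x) ->
  exists d : R, 0 < d /\ forall i x, `|x| <= d -> P i x.
Proof.
move=> /choice [d hd]; exists (\big[Num.min/1]_(i : I) d i); split.
  by apply: lt_bigmin => // i _; exact: (hd i).1.
move=> i x hx; apply: (hd i).2; apply: (le_trans hx).
exact: bigmin_le.
Qed.

Lemma is_ps_ord_coef (R : realType) (f : R -> R) (c : nat -> R) (k : nat) :
  is_ps f c -> ord_coef_eq c k ->
  exists d lo hi : R, [/\ 0 < d, 0 < lo, 0 < hi & forall x, `|x| <= d ->
    lo * `|x| ^+ k <= `|f x| <= hi * `|x| ^+ k].
Proof.
move=> fc [c0 ck].
have [r [K [r0 K0 hf]]] := is_ps_taylor k.+1 fc.
have ck0 : 0 < `|c k| by rewrite normr_gt0.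
have K1 : 0 < K + 1 by lra.
(* Within this radius the Taylor remainder [K * |x| ^+ k.+1] is at most half of the leading term. *)
exists (Num.min r (`|c k| / 2 / (K + 1))), (`|c k| / 2), (`|c k| * 2); split.
- by rewrite lt_min r0 !divr_gt0.
- by rewrite divr_gt0.
- by rewrite mulr_gt0.
move=> x; rewrite le_min => /andP[xr xk].
have := hf x xr; rewrite /psum1 big_ord_recr /= big1 ?add0r; last by move=> i _; rewrite c0 // mul0r.
rewrite exprS mulrA; set X := `|x| ^+ k => h.
have X0 : 0 <= X by rewrite exprn_ge0.
have hx : K * `|x| <= `|c k| / 2.
  move: xk; rewrite ler_pdivlMr // => xk; have := normr_ge0 x; nra.
have hKX : `|f x - c k * x ^+ k| <= `|c k| / 2 * X by apply: (le_trans h); rewrite ler_wpM2r.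
have nX : `|c k * x ^+ k| = `|c k| * X by rewrite normrM normrX.
have h1 := lerB_dist (c k * x ^+ k) (f x).
have h2 := ler_normD (f x - c k * x ^+ k) (c k * x ^+ k).
rewrite subrK in h2; rewrite distrC in h1.
have cX : 0 <= `|c k| * X by rewrite mulr_ge0 // ltW.
by rewrite nX in h1 h2; apply/andP; split; lra.
Qed.

Section large_on_interval.
Variables (R : realType) (D : nat).

Let lag (l : 'I_D) (s : R) : R :=
  \prod_(i < D | i != l) ((s - i%:R) / (l%:R - i%:R)).

Let lag_node (l i : 'I_D) : lag l i%:R = (l == i)%:R.
Proof.
rewrite /lag; have [->|li] := eqVneq l i; last first.
  by rewrite (bigD1 i) 1?eq_sym //= subrr !mul0r.
by rewrite big1 // => j ji; rewrite divff // subr_eq0 eqr_nat eq_sym.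
Qed.

(** With tolerance [1 / (2 D)] per basis polynomial, the [D] errors add up to at most half of the
    largest node value. *)
Let lag_cont : exists eta : R, [/\ 0 < eta, eta <= 1 & forall (l i : 'I_D) (s : R),
  `|s| <= eta -> `|lag l (i%:R + s) - (l == i)%:R| <= (2 * D%:R)^-1].
Proof.
have [D0|D0] := posnP D.
  exists 1; split => // l; exfalso; have := leq_ltn_trans (leq0n l) (ltn_ord l).
  by rewrite [X in (_ < X)%N]D0.
have eps0 : 0 < (2 * D%:R)^-1 :> R by rewrite invr_gt0 mulr_gt0 // ltr0n.
have /fin_radius [eta [eta0 heta]] : forall li : 'I_D * 'I_D, exists d : R, 0 < d /\
    forall s, `|s| <= d -> `|lag li.1 (li.2%:R + s) - (li.1 == li.2)%:R| <= (2 * D%:R)^-1.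
  move=> [l i] /=.
  pose p : {poly R} := \prod_(j < D | j != l) ((l%:R - j%:R)^-1 *: ('X - (j%:R)%:P)).
  have pE s : p.[s] = lag l s.
    by rewrite horner_prod; apply: eq_bigr => j _; rewrite hornerZ hornerXsubC mulrC.
  have /cvgrPdist_le/(_ _ eps0) := @continuous_horner _ p i%:R.
  move=> /nbhs_ballP[e /= e0 he]; exists (e / 2); split; first by rewrite divr_gt0.
  move=> s hs; have := he (i%:R + s); rewrite !pE lag_node distrC; apply.
  by rewrite /ball /= opprD addNKr normrN; apply: le_lt_trans hs _; rewrite ltr_pdivrMr //; lra.
exists (Num.min eta 1); split; rewrite ?lt_min ?eta0 ?ltr01 ?ge_min ?lexx ?orbT //.
by move=> l i s; rewrite le_min => /andP[hs _]; exact: (heta (l, i)).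
Qed.

(* In the rescaled variable s, the function is up to a negligible error its
   interpolant at the nodes 0, ..., k; near the node where it is largest the
   interpolant keeps at least half of that value. *)
Lemma evalR2_large_on_interval (c : nat -> nat -> R) (r K d c0 : R) (a : R -> R) (e k : nat) :
  D = k.+1 -> coef2_le c r K -> (0 < e)%N -> 0 < d -> 0 < c0 ->
  (forall x : R, 0 < x <= d -> `|a x| <= r / 4) ->
  (forall x : R, 0 < x <= d -> c0 * x ^+ k <= `|evalR2 c x (a x)|) ->
  exists d' eta c1 : R, [/\ 0 < d', 0 < eta, 0 < c1 & forall x : R, 0 < x <= d' ->
    exists s0 : R, forall s, s0 <= s <= s0 + eta ->
      0 <= s <= D%:R /\ c1 * x ^+ k <= `|evalR2 c x (a x + s * x ^+ e)|].
Proof.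
move=> DE hc e0 d0 c00 ha hQ.
have r0 := hc.1; have K0 := coef2_le_ge0 hc.
have [eta [eta0 eta1 heta]] := lag_cont.
(* The number of nodes is [k + 1] for this reason: the error contains [D] factors, each at most
   [D%:R * x] as [e > 0], hence is at most [E * x ^+ k.+1], one order below the main term
   [x ^+ k]. *)
pose E : R := 2 * (2 * K * (2 / r) ^+ D) * D%:R ^+ D.
have E0 : 0 <= E.
  by rewrite !mulr_ge0 ?exprn_ge0 // divr_ge0 // ltW.
have D0 : 0 < D%:R :> R by rewrite ltr0n DE.
(* [r / 4 / D%:R] keeps nodes and evaluation points in the half disc. The last entry makes the error
   at most [c0 / 4 * x ^+ k]; taken from half of the largest node value, it leaves the constant
   [c0 / 4]. *)
pose d' := Num.min (Num.min d 1) (Num.min (r / 4 / D%:R) (c0 / (4 * (E + 1)))).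
have E1 : 0 < 4 * (E + 1) by lra.
have d'0 : 0 < d' by rewrite !lt_min d0 ltr01 !divr_gt0.
exists d', eta, (c0 / 4); split => //; first by rewrite divr_gt0.
move=> x /andP[x0]; rewrite !le_min => /andP[/andP[xd x1] /andP[xr xE]].
have xd0 : 0 < x <= d by rewrite x0.
pose F (i : 'I_D) := evalR2 c x (a x + i%:R * x ^+ e).
have lt0D : (0 < D)%N by rewrite DE.
pose o : 'I_D := Ordinal lt0D.
(* The maximising node may change with [x]; only the length [eta] of the interval is uniform. Node 0
   is the branch itself, so the maximum is at least [c0 * x ^+ k]. *)
have [i0 _ hmax] := @Order.TotalTheory.arg_maxP _ _ _ o xpredT (fun i => `|F i|) isT.
exists i0%:R => s /andP[s1 s2].
have iD : i0%:R <= D%:R - 1 :> R.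
  by have := ltn_ord i0; rewrite -(ler_nat R) -natr1; lra.
have i00 : 0 <= i0%:R :> R by [].
have sD : 0 <= s <= D%:R by apply/andP; split; lra.
split => //; move: sD => /andP[s00 sD].
have xe : x ^+ e <= x.
  by case: e e0 {F hmax} => // e' _; rewrite exprS ler_piMr ?(ltW x0) // exprn_ile1 // ltW.
have xe0 : 0 < x ^+ e by rewrite exprn_gt0.
have hax := ha x xd0.
have small t : 0 <= t <= D%:R -> `|a x + t * x ^+ e| <= r / 2.
  move=> /andP[t0 tD]; apply: (le_trans (ler_normD _ _)).
  rewrite (ger0_norm (_ : 0 <= t * _)) ?mulr_ge0 ?(ltW xe0) //.
  have : t * x ^+ e <= D%:R * x by apply: ler_pM => //; exact: ltW.
  by move: xr; rewrite ler_pdivlMr //; lra.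
have nodes_inj : injective (fun i : 'I_D => a x + i%:R * x ^+ e).
  have xen0 : x ^+ e != 0 by rewrite gt_eqF.
  move=> i j /addrI /(mulIf xen0) /eqP; rewrite eqr_nat => /eqP; exact: val_inj.
have xr2 : `|x| <= r / 2.
  rewrite gtr0_norm //; move: xr; rewrite ler_pdivlMr // => xr.
  have : x <= x * D%:R by rewrite ler_peMr ?(ltW x0) // DE ler1n.
  by lra.
have hs : 0 <= s <= D%:R by rewrite s00.
have nodeB t v : a x + t * x ^+ e - (a x + v * x ^+ e) = (t - v) * x ^+ e by ring.
have hnode (i : 'I_D) : 0 <= (i%:R : R) <= D%:R by rewrite ler0n ler_nat ltnW.
have := evalR2_interpolation hc nodes_inj xr2 (small s hs) (fun i => small _ (hnode i)).
have -> : \sum_(j < D) evalR2 c x (a x + j%:R * x ^+ e) *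
   \prod_(i < D | i != j) ((a x + s * x ^+ e - (a x + i%:R * x ^+ e)) /
      (a x + j%:R * x ^+ e - (a x + i%:R * x ^+ e))) = \sum_(j < D) F j * lag j s.
  apply: eq_bigr => j _; congr (_ * _); apply: eq_bigr => i ij.
  rewrite !nodeB -mulf_div divff ?mulr1 //.
  by rewrite gt_eqF.
set T := \sum_(j < D) _ => herr.
have herr' : `|evalR2 c x (a x + s * x ^+ e) - T| <= E * x ^+ k.+1.
  apply: (le_trans herr); rewrite /E -[X in _ <= X]mulrA ler_wpM2l //.
    by rewrite !mulr_ge0 ?exprn_ge0 // divr_ge0 // ltW.
  apply: (@le_trans _ _ (\prod_(j < D) (D%:R * x))).
    apply: ler_prod => j _; rewrite normr_ge0 /= nodeB normrM.
    rewrite (gtr0_norm xe0) ler_pM ?(ltW xe0) //.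
    have := hnode j => /andP[j0 jD].
    by rewrite ler_norml; apply/andP; split; lra.
  by rewrite prodr_const card_ord exprMn DE.
have hT : `|T - F i0| <= `|F i0| / 2.
  have -> : T - F i0 = \sum_(j < D) F j * (lag j s - (j == i0)%:R).
    under [RHS]eq_bigr do rewrite mulrBr.
    rewrite sumrB; congr (_ - _); rewrite (bigD1 i0) //= eqxx mulr1 big1 ?addr0 //.
    by move=> j /negPf ->; rewrite mulr0.
  apply: (le_trans (ler_norm_sum _ _ _)).
  apply: (@le_trans _ _ (\sum_(j < D) `|F i0| * (2 * D%:R)^-1)).
    apply: ler_sum => j _; rewrite normrM ler_pM //; first exact: hmax.
    have := heta j i0 (s - i0%:R); rewrite subrKC; apply.
    by rewrite ler_norml; apply/andP; split; lra.
  rewrite sumr_const card_ord -mulr_natr le_eqVlt; apply/orP; left; apply/eqP.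
  by field; rewrite gt_eqF.
have hF : c0 * x ^+ k <= `|F i0|.
  apply: le_trans (hQ x xd0) _; have := hmax o isT; rewrite /F /= mul0r addr0; exact.
have xk0 : 0 <= x ^+ k by rewrite exprn_ge0 // ltW.
have hEx : E * x ^+ k.+1 <= c0 / 4 * x ^+ k.
  rewrite exprS mulrA ler_wpM2r //.
  by move: xE; rewrite ler_pdivlMr // => xE; nra.
set V := evalR2 _ _ _ in herr' *.
have h1 := ler_normD (F i0 - V) V; rewrite subrK in h1.
have h2 := ler_distD T (F i0) V.
rewrite distrC in hT; rewrite distrC in herr'.
lra.
Qed.

End large_on_interval.

(** * Branches *)

Section branches.
Variables (R : realType) (M : nat) (L : 'I_M -> nat) (q : 'I_M -> {poly R}).
Variable psi : 'I_M -> nat -> R.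
Hypothesis hL : forall j, (0 < L j)%N.
Hypothesis hq0 : forall j, (q j).[0] = 0.
Hypothesis hpsi : forall j, conv_series1R (psi j).
Hypothesis hord :
  forall i j : 'I_M, i != j -> ord_coef_eq (branch_diff_coef L q psi i j) (Oij L q i j).

Local Notation a := (branch L q psi).

Let bcoef j n : R := - (q j)`_n - (if (2 * L j <= n)%N then psi j (n - 2 * L j)%N else 0).

Lemma branch_is_ps j : is_ps (a j) (bcoef j).
Proof.
apply: is_psD; first exact: is_psN (is_ps_poly (q j)).
exact: is_psN (is_ps_shift (2 * L j) (is_ps_evalR1 (hpsi j))).
Qed.

Lemma branch_coef0 j : bcoef j 0 = 0.
Proof.
by rewrite /bcoef leqNgt muln_gt0 hL /= -horner_coef0 hq0 oppr0 addr0.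
Qed.

Lemma branch_le j : exists d K : R, [/\ 0 < d, 0 <= K &
  forall x, `|x| <= d -> `|a j x| <= K * `|x|].
Proof.
have [d [K [d0 K0 h]]] := is_ps_taylor 1 (branch_is_ps j).
exists d, K; split => // x /h.
by rewrite /psum1 big_ord1 branch_coef0 mul0r subr0 expr1.
Qed.

Lemma branch_diff_bounds i j : i != j -> exists d lo hi : R,
  [/\ 0 < d, 0 < lo, 0 < hi & forall x, `|x| <= d ->
    lo * `|x| ^+ Oij L q i j <= `|a i x - a j x| <= hi * `|x| ^+ Oij L q i j].
Proof.
move=> ij; apply: (is_ps_ord_coef _ (hord ij)).
(* The indices reverse because the branches carry minus signs: [branch_diff_coef] at [i], [j]
   expands [a_i - a_j]. *)
have -> : branch_diff_coef L q psi i j = (fun n => bcoef i n - bcoef j n).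
  by apply/funext => n; rewrite /branch_diff_coef /bcoef coefB; ring.
by apply: is_psD; [|apply: is_psN]; exact: branch_is_ps.
Qed.

Definition pfactor j x y : R :=
  cmod (RtoC (y + (q j).[x]) + Complex 0 1 * RtoC (x ^+ (2 * L j))).

Lemma cmod_Pprod x y : cmod (Pprod L q x y) = \prod_(j < M) pfactor j x y.
Proof. exact: cmod_prod. Qed.

Lemma norm_even_pow (x : R) (n : nat) : `|x| ^+ (2 * n) = x ^+ (2 * n).
Proof. by rewrite !exprM real_normK ?num_real. Qed.

(** The real part of the factor differs from [y - a j x] by [x^(2 L_j) psi_j], and [psi_j] is
    bounded near 0. The imaginary part is [x^(2 L_j)], nonnegative since the exponent is even, so it
    pays for that difference in both directions. *)
Lemma pfactor_bounds j : exists d B : R, [/\ 0 < d, 0 <= B & forall x y, `|x| <= d ->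
  `|y - a j x| + `|x| ^+ (2 * L j) <= (2 + B) * pfactor j x y /\
  pfactor j x y <= `|y - a j x| + (1 + B) * `|x| ^+ (2 * L j)].
Proof.
have [d [B [d0 B0 h]]] := is_ps_taylor 0 (is_ps_evalR1 (hpsi j)).
exists d, B; split => // x y xd; have := h x xd.
rewrite /psum1 big_ord0 subr0 expr0 mulr1; set ps := evalR1 _ _ => hps.
rewrite norm_even_pow; set X := x ^+ (2 * L j).
have X0 : 0 <= X by rewrite /X -norm_even_pow exprn_ge0.
pose z : R[i] := RtoC (y + (q j).[x]) + Complex 0 1 * RtoC X; have zE : pfactor j x y = cmod z by [].
have Rez : complex.Re z = y + (q j).[x] by rewrite /= mul0r mulr0 subr0 addr0.
have Imz : complex.Im z = X by rewrite /= mul1r mul0r !add0r.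
have := Re_le_cmod z; have := Im_le_cmod z; have := cmod_le_ReIm z.
rewrite zE Rez Imz (ger0_norm X0); set W := cmod z; set Y := y + (q j).[x].
have -> : y - a j x = Y + X * ps by rewrite /branch /Y /X /ps; ring.
move=> h1 h2 h3.
have hXps : `|X * ps| <= B * X by rewrite normrM ger0_norm // mulrC ler_wpM2r.
have h4 := ler_normD Y (X * ps).
have h5 := ler_normB (Y + X * ps) (X * ps); rewrite addrK in h5.
have BX : B * X <= B * W by rewrite ler_wpM2l.
by split; lra.
Qed.

Lemma Oij_diag j : Oij L q j j = (2 * L j)%N.
Proof. by rewrite /Oij subrr eqxx minnn. Qed.

Lemma Oij_le i j : (Oij L q i j <= 2 * L i)%N /\ (Oij L q i j <= 2 * L j)%N.
Proof. by rewrite /Oij; case: ifP => _; split; lia. Qed.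

Lemma Oij_sum j :
  (\sum_(i < M) Oij L q i j = 2 * L j + \sum_(i < M | i != j) Oij L q i j)%N.
Proof. by rewrite (bigD1 j) //= Oij_diag. Qed.

Lemma pfactor_ge0 j x y : 0 <= pfactor j x y.
Proof. exact: cmod_ge0. Qed.

(* Near branch j each factor of P is O(|x|^O_ij), because O_ij <= 2 L_i, 2 L_j. *)
Lemma Pprod_upper j (D : R) : 0 <= D -> exists d C : R, [/\ 0 < d, 0 < C &
  forall x y : R, 0 < x <= d -> `|y - a j x| <= D * x ^+ (2 * L j) ->
    0 < cmod (Pprod L q x y) <= C * x ^+ (\sum_(i < M) Oij L q i j)].
Proof.
move=> D0.
have hd i : exists dh : R * R, 0 < dh.1 /\ forall x, `|x| <= dh.1 ->
    `|a i x - a j x| <= dh.2 * `|x| ^+ Oij L q i j.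
  have [->|ij] := eqVneq i j.
    by exists (1, 0); split => // x _; rewrite subrr normr0 mul0r.
  have [d [lo [hi [d0 _ _ h]]]] := branch_diff_bounds ij.
  by exists (d, hi); split => // x /h /andP[].
have /choice[dB hdB] : forall i, exists dB : R * R, [/\ 0 < dB.1, 0 <= dB.2 & forall x y, `|x| <= dB.1 ->
    `|y - a i x| + `|x| ^+ (2 * L i) <= (2 + dB.2) * pfactor i x y /\
     pfactor i x y <= `|y - a i x| + (1 + dB.2) * `|x| ^+ (2 * L i)].
  by move=> i; have [d [B [d0 B0 h]]] := pfactor_bounds i; exists (d, B).
move: hd => /choice[dh hdh].
(* The three contributions to factor [i]: [D] from [y - a_j], the next constant from [a_j - a_i],
   and [1 + B] from the term in [x^(2 L_i)]. *)
pose Cf i : R := D + `|(dh i).2| + 1 + (dB i).2.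
have Cf0 i : 0 < Cf i.
  have [_ B0 _] := hdB i; rewrite /Cf; have := normr_ge0 (dh i).2; lra.
have /fin_radius [d [d0 hd]] : forall i, exists d : R, 0 < d /\ forall x : R, `|x| <= d ->
    `|x| <= (dh i).1 /\ `|x| <= (dB i).1.
  move=> i; exists (Num.min (dh i).1 (dB i).1); split.
    by rewrite lt_min (hdh i).1; have [-> _ _] := hdB i.
  by move=> x; rewrite le_min => /andP[].
exists (Num.min d 1), (\prod_(i < M) Cf i); split.
- by rewrite lt_min d0 ltr01.
- by apply: prodr_gt0.
move=> x y; rewrite le_min => /and3P[x0 xd x1] hy.
rewrite cmod_Pprod; have nx : `|x| = x by rewrite gtr0_norm.
have key i : 0 < pfactor i x y <= Cf i * x ^+ Oij L q i j.
  have [|xdh xdB] := hd i x; first by rewrite nx.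
  have [_ B0 /(_ x y xdB) []] := hdB i.
  rewrite nx => h1 h2; have h3 := (hdh i).2 _ xdh; rewrite nx in h3.
  have xp n : 0 < x ^+ n by rewrite exprn_gt0.
  have [Oi Oj] := Oij_le i j.
  have xi : x ^+ (2 * L i) <= x ^+ Oij L q i j by rewrite ler_wiXn2l // ltW.
  have xj : x ^+ (2 * L j) <= x ^+ Oij L q i j by rewrite ler_wiXn2l // ltW.
  have B20 : 0 < 2 + (dB i).2 by lra.
  apply/andP; split.
    rewrite -(pmulr_rgt0 _ B20); apply: lt_le_trans h1.
    by have := normr_ge0 (y - a i x); have := xp (2 * L i)%N; lra.
  apply: (le_trans h2).
  have h4 := ler_distD (a j x) y (a i x).
  rewrite [X in _ <= _ + X]distrC in h4.
  have h5 : (dh i).2 * x ^+ Oij L q i j <= `|(dh i).2| * x ^+ Oij L q i j.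
    by rewrite ler_wpM2r ?ler_norm // ltW.
  have h6 : D * x ^+ (2 * L j) <= D * x ^+ Oij L q i j by rewrite ler_wpM2l.
  have h7 : (1 + (dB i).2) * x ^+ (2 * L i) <= (1 + (dB i).2) * x ^+ Oij L q i j.
    by rewrite ler_wpM2l //; lra.
  rewrite /Cf !mulrDl; lra.
apply/andP; split; first by apply: prodr_gt0 => i _; have /andP[] := key i.
rewrite expr_sum -big_split /=; apply: ler_prod => i _.
by rewrite pfactor_ge0; have /andP[] := key i.
Qed.

End branches.

(** * Pointwise bound on the quotient *)

Lemma powR_1Dsum_le (R : realType) (M : nat) (u : 'I_M -> R) (p : R) : 0 <= p ->
  (forall j, 0 <= u j) ->
  (1 + \sum_(j < M) u j) `^ p <= M.+1%:R `^ p * (1 + \sum_(j < M) u j `^ p).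
Proof.
(* The sum has [M + 1] terms, none above [m], and [m] raised to the power [p] is itself one of the
   summands on the right. *)
move=> p0 u0; pose m := \big[Num.max/1]_(j < M) u j.
have m1 : 1 <= m by exact: bigmax_ge_id.
have um j : u j <= m by exact: le_bigmax_cond.
have sp0 : 0 <= \sum_(j < M) u j `^ p by rewrite sumr_ge0 // => j _; rewrite powR_ge0.
have mp : m `^ p <= 1 + \sum_(j < M) u j `^ p.
  apply: (big_ind (fun v => v `^ p <= 1 + \sum_(j < M) u j `^ p)).
  - by rewrite powR1; lra.
  - by move=> v w hv hw; rewrite /Num.max; case: ifP.
  - move=> j _; rewrite (bigD1 j) //=.
    have : 0 <= \sum_(i < M | i != j) u i `^ p by rewrite sumr_ge0 // => i _; rewrite powR_ge0.
    by lra.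
apply: (@le_trans _ _ ((M.+1%:R * m) `^ p)); last first.
  by rewrite powRM ?(le_trans ler01 m1) // ler_wpM2l ?powR_ge0.
apply: ge0_ler_powR => //; rewrite ?nnegrE.
- by rewrite addr_ge0 // sumr_ge0.
- by rewrite mulr_ge0 // (le_trans ler01 m1).
rewrite mulrSr mulrDl mul1r addrC lerD //.
apply: (@le_trans _ _ (\sum_(j < M) m)); first by apply: ler_sum.
by rewrite sumr_const card_ord mulr_natl.
Qed.

(** After splitting the power of [z + X ^+ l], the exponent of [X] is [(k - S) p - l (p - 1 + dl)];
    the hypothesis on [dl] says exactly that it is at least [-(1 - dl)], which suffices since
    [X <= 1]. *)
Lemma branch_term_powR_le (R : realType) (X z p dl : R) (k S l : nat) :
  0 < X <= 1 -> 0 < z -> 1 <= p -> 0 < dl < 1 ->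
  dl * l.+1%:R <= (k%:R - S%:R) * p - l%:R * (p - 1) + 1 ->
  (X ^+ k / (X ^+ S * (z + X ^+ l))) `^ p <= X `^ (- (1 - dl)) * z `^ (- (1 - dl)).
Proof.
move=> /andP[X0 X1] z0 p1 /andP[dl0 dl1] hdl.
have Xn n : 0 < X ^+ n by rewrite exprn_gt0.
have Xne : X != 0 by rewrite gt_eqF.
have w0 : 0 < z + X ^+ l by rewrite addr_gt0.
have wne : z + X ^+ l != 0 by rewrite gt_eqF.
have -> : X ^+ k / (X ^+ S * (z + X ^+ l)) = X `^ (k%:R - S%:R) * (z + X ^+ l)^-1.
  by rewrite powRB ?Xne ?implybT // !powR_mulrn ?(ltW X0) // invfM mulrA.
rewrite powRM ?powR_ge0 ?invr_ge0 ?(ltW w0) // -powRrM.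
rewrite -powR_inv1 ?(ltW w0) // -powRrM mulN1r.
rewrite (_ : - p = - (1 - dl) + - (p - 1 + dl)); last by ring.
rewrite (@powRD _ (z + _)); last by rewrite wne implybT.
have h1 : (z + X ^+ l) `^ (- (1 - dl)) <= z `^ (- (1 - dl)).
  rewrite !powRN lef_pV2 ?posrE ?powR_gt0 //.
  apply: ge0_ler_powR; rewrite ?nnegrE ?(ltW w0) ?(ltW z0) ?lerDl ?(ltW (Xn l)) //; lra.
have h2 : (z + X ^+ l) `^ (- (p - 1 + dl)) <= X `^ (l%:R * - (p - 1 + dl)).
  rewrite powRrM powR_mulrn ?(ltW X0) // !(powRN _ (p - 1 + dl)) lef_pV2 ?posrE ?powR_gt0 //.
  apply: ge0_ler_powR; rewrite ?nnegrE ?(ltW w0) ?(ltW (Xn l)) ?lerDr ?(ltW z0) //; lra.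
apply: (@le_trans _ _ (X `^ ((k%:R - S%:R) * p) * (z `^ (- (1 - dl)) * X `^ (l%:R * - (p - 1 + dl))))).
  by rewrite ler_wpM2l ?powR_ge0 // ler_pM ?powR_ge0.
rewrite mulrCA mulrC -powRD ?Xne ?implybT // ler_wpM2r ?powR_ge0 //.
apply: ger_powR; rewrite ?X0 //.
move: hdl; rewrite -natr1; lra.
Qed.

Section quotient_bound.
Variables (R : realType) (M : nat) (L : 'I_M -> nat) (q : 'I_M -> {poly R}).
Variable psi : 'I_M -> nat -> R.
Hypothesis hL : forall j, (0 < L j)%N.
Hypothesis hq0 : forall j, (q j).[0] = 0.
Hypothesis hpsi : forall j, conv_series1R (psi j).
Hypothesis hord :
  forall i j : 'I_M, i != j -> ord_coef_eq (branch_diff_coef L q psi i j) (Oij L q i j).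

Local Notation a := (branch L q psi).
Local Notation S j := (\sum_(i < M | i != j) Oij L q i j)%N.

Lemma branches_small (e : R) : 0 < e ->
  exists d : R, 0 < d /\ forall j x, `|x| <= d -> `|a j x| <= e.
Proof.
move=> e0; apply: (fin_radius (P := fun j x => `|a j x| <= e)) => j.
have [d [K [d0 K0 h]]] := branch_le hL hq0 hpsi j.
have K1 : 0 < K + 1 by lra.
exists (Num.min d (e / (K + 1))); split; first by rewrite lt_min d0 divr_gt0.
move=> x; rewrite le_min ler_pdivlMr // => /andP[/h h1 h2].
by apply: (le_trans h1); have := normr_ge0 x; lra.
Qed.

Lemma quotient_pointwise_bound (Q : nat -> nat -> R[i]) (k : 'I_M -> nat) :
  conv_series2 Q ->
  (forall j, exists d K : R, [/\ 0 < d, 0 <= K & forall x, `|x| <= d ->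
      cmod (evalC2 Q x (a j x)) <= K * `|x| ^+ k j]) ->
  exists d A : R, [/\ 0 < d, 0 < A & forall x y, `|x| <= d -> `|y| <= d -> x != 0 ->
    cmod (evalC2 Q x y / Pprod L q x y) <= A * (1 + \sum_(j < M)
      `|x| ^+ k j / (`|x| ^+ S j * (`|y - a j x| + `|x| ^+ (2 * L j))))].
Proof.
move=> /conv_series2_parts [r [K [hc1 hc2]]] hk.
have r0 := hc1.1; have K0 := coef2_le_ge0 hc1.
have /choice[dk hdk] : forall j, exists dk : R * R, [/\ 0 < dk.1, 0 <= dk.2 &
    forall x, `|x| <= dk.1 -> cmod (evalC2 Q x (a j x)) <= dk.2 * `|x| ^+ k j].
  by move=> j; have [d [K' [d0 K'0 h]]] := hk j; exists (d, K').
have /choice[dB hdB] : forall i, exists dB : R * R, [/\ 0 < dB.1, 0 <= dB.2 & forall x y, `|x| <= dB.1 ->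
    `|y - a i x| + `|x| ^+ (2 * L i) <= (2 + dB.2) * pfactor L q i x y /\
     pfactor L q i x y <= `|y - a i x| + (1 + dB.2) * `|x| ^+ (2 * L i)].
  by move=> i; have [d [B [d0 B0 h]]] := pfactor_bounds L q hpsi i; exists (d, B).
have /choice[dl hdl] : forall ij : 'I_M * 'I_M, exists dl : R * R, [/\ 0 < dl.1, 0 < dl.2 &
    forall x, `|x| <= dl.1 -> ij.1 != ij.2 ->
      dl.2 * `|x| ^+ Oij L q ij.1 ij.2 <= `|a ij.2 x - a ij.1 x|].
  move=> [i j] /=; have [_|ij] := eqVneq i j; first by exists (1, 1).
  have [d [lo [hi [d0 lo0 _ h]]]] := branch_diff_bounds hpsi hord ij.
  by exists (d, lo); split => // x /h /andP[hlo _] _; rewrite distrC.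
have /fin_radius[d1 [d10 hd1]] : forall j, exists d : R, 0 < d /\ forall x : R, `|x| <= d ->
    `|x| <= (dk j).1 /\ `|x| <= (dB j).1.
  move=> j; exists (Num.min (dk j).1 (dB j).1); split.
    by rewrite lt_min; have [-> _ _] := hdk j; have [-> _ _] := hdB j.
  by move=> x; rewrite le_min => /andP[].
have /fin_radius[d2 [d20 hd2]] : forall ij, exists d : R, 0 < d /\ forall x : R, `|x| <= d ->
    `|x| <= (dl ij).1.
  by move=> ij; exists (dl ij).1; split => //; have [] := hdl ij.
have r20 : 0 < r / 2 by rewrite divr_gt0.
have [d3 [d30 hd3]] := branches_small r20.
pose E : R := 2 * (2 * K * (2 / r) ^+ M).
have E0 : 0 <= E by rewrite !mulr_ge0 ?exprn_ge0 // divr_ge0 // ltW.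
(* [G i] is the cost of replacing [|y - a_i|] by the factor of index [i] of [P]. [H j] collects the
   costs of the [j]-th Lagrange basis polynomial: one [G i] per numerator and one lower constant of
   [a_j - a_i] per denominator. *)
pose G i : R := 2 + (dB i).2.
have G0 i : 0 < G i by have [_ B0 _] := hdB i; rewrite /G; lra.
pose H j : R := G j * \prod_(i < M | i != j) (G i / (dl (i, j)).2).
have lo0 ij : 0 < (dl ij).2 by have [] := hdl ij.
have H0 j : 0 < H j by rewrite mulr_gt0 // prodr_gt0 // => i _; rewrite divr_gt0.
have k0 j : 0 <= (dk j).2 by have [] := hdk j.
have GG0 : 0 <= \prod_(i < M) G i by apply: prodr_ge0 => i _; exact: ltW.
have KH0 : 0 <= \sum_(j < M) (dk j).2 * H j.
  by apply: sumr_ge0 => j _; rewrite mulr_ge0 // ltW.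
exists (Num.min (Num.min d1 d2) (Num.min d3 (r / 2))),
  (2 * (E * \prod_(i < M) G i + \sum_(j < M) (dk j).2 * H j) + 1).
have EG0 : 0 <= E * \prod_(i < M) G i by rewrite mulr_ge0.
split; [by rewrite !lt_min d10 d20 d30 | lra | ].
move=> x y; rewrite !le_min => /andP[/andP[x1 x2] /andP[x3 x4]] /andP[_ /andP[_ y4]] xn0.
set X := `|x|; have X0 : 0 < X by rewrite normr_gt0.
have Xn n : 0 < X ^+ n by rewrite exprn_gt0.
pose f i := pfactor L q i x y; pose z i := `|y - a i x|.
have z0 i : 0 <= z i by exact: normr_ge0.
have hf i : z i + X ^+ (2 * L i) <= G i * f i.
  by have [_ _ h] := hdB i; exact: (h x y (hd1 i x x1).2).1.
have f0 i : 0 < f i.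
  rewrite -(pmulr_rgt0 _ (G0 i)); apply: lt_le_trans (hf i).
  by have := z0 i; have := Xn (2 * L i)%N; lra.
have hzf i : z i <= G i * f i by apply: le_trans (hf i); rewrite lerDl ltW.
have hlo i j : i != j -> (dl (i, j)).2 * X ^+ Oij L q i j <= `|a j x - a i x|.
  by move=> ij; have [_ _ h] := hdl (i, j); apply: h => //; exact: hd2.
(* For [x != 0] the exact orders keep the nodes apart, as interpolation requires. *)
have a_inj : injective (fun j => a j x).
  move=> i j e; apply/eqP/negPn/negP => /hlo.
  by rewrite e subrr normr0 leNgt mulr_gt0.
have W0 : 0 < \prod_(i < M) f i by apply: prodr_gt0.
pose v j := X ^+ k j / (X ^+ S j * (z j + X ^+ (2 * L j))).
have zX j : 0 < z j + X ^+ (2 * L j) by have := z0 j; have := Xn (2 * L j)%N; lra.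
have v0 j : 0 <= v j by rewrite divr_ge0 ?ltW // mulr_gt0.
have term j : (dk j).2 * X ^+ k j * \prod_(i < M | i != j) (z i / `|a j x - a i x|)
    <= (dk j).2 * H j * v j * \prod_(i < M) f i.
  have h1 : \prod_(i < M | i != j) (z i / `|a j x - a i x|) <=
      \prod_(i < M | i != j) (G i / (dl (i, j)).2) / X ^+ S j * \prod_(i < M | i != j) f i.
    rewrite expr_sum -prodf_div -big_split /=; apply: ler_prod => i ij.
    rewrite divr_ge0 //=; have ha0 : 0 < `|a j x - a i x|.
      by apply: lt_le_trans (hlo _ _ ij); rewrite mulr_gt0.
    rewrite ler_pdivrMr //.
    apply: (@le_trans _ _ (G i / (dl (i, j)).2 / X ^+ Oij L q i j * f i *
        ((dl (i, j)).2 * X ^+ Oij L q i j))); last first.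
      by rewrite ler_wpM2l ?hlo // mulr_ge0 ?divr_ge0 ?ltW.
    apply: le_trans (hzf i) _; rewrite le_eqVlt; apply/orP; left; apply/eqP.
    have n1 : (dl (i, j)).2 != 0 by rewrite gt_eqF.
    have n2 : X ^+ Oij L q i j != 0 by rewrite gt_eqF.
    by field; rewrite n1 n2.
  (* The [j]-th basis polynomial lacks the factor of index [j]. Restoring it to complete the product
     [|P|] costs one division by [|y - a_j| + |x|^(2 L_j)], which is the singularity seen in the
     bound. *)
  have h2 : 1 <= G j / (z j + X ^+ (2 * L j)) * f j.
    by rewrite mulrAC ler_pdivlMr // mul1r.
  rewrite -!mulrA ler_wpM2l //.
  set P1 := \prod_(i < M | i != j) (G i / (dl (i, j)).2) in h1 *.
  rewrite [\prod_(i < M) f i](bigD1 j) //=; set P2 := \prod_(i < M | i != j) f i in h1 *.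
  have P10 : 0 <= P1 by apply: prodr_ge0 => i _; rewrite divr_ge0 // ltW.
  have P20 : 0 <= P2 by apply: prodr_ge0 => i _; rewrite ltW.
  apply: (@le_trans _ _ (X ^+ k j * (P1 / X ^+ S j * P2))).
    by apply: ler_wpM2l; [exact: ltW|exact: h1].
  have B0 : 0 <= X ^+ k j * (P1 / X ^+ S j * P2) by rewrite !mulr_ge0 ?invr_ge0 // ltW.
  apply: (le_trans (ler_peMr B0 h2)); rewrite le_eqVlt; apply/orP; left; apply/eqP.
  have n1 : X ^+ S j != 0 by rewrite gt_eqF.
  have n2 : z j + X ^+ (2 * L j) != 0 by rewrite gt_eqF.
  by rewrite /H -/P1 /v; field; rewrite n1 n2.
(* Applied to the real and to the imaginary part of [Q]; their sum accounts for the factor 2 in the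
   final constant. *)
have part (c : nat -> nat -> R) : coef2_le c r K ->
    (forall j, `|evalR2 c x (a j x)| <= (dk j).2 * X ^+ k j) ->
    `|evalR2 c x y| <= (E * \prod_(i < M) G i + \sum_(j < M) (dk j).2 * H j * v j)
       * \prod_(i < M) f i.
  move=> hc hcj.
  have := evalR2_interpolation hc a_inj x4 y4 (fun j => hd3 j x x3).
  rewrite -/E; set I := \sum_(j < M) _ => hI.
  have hz : \prod_(j < M) z j <= (\prod_(i < M) G i) * \prod_(i < M) f i.
    by rewrite -big_split /=; apply: ler_prod => i _; rewrite z0 hzf.
  have hI2 : `|I| <= (\sum_(j < M) (dk j).2 * H j * v j) * \prod_(i < M) f i.
    rewrite mulr_suml; apply: (le_trans (ler_norm_sum _ _ _)); apply: ler_sum => j _.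
    apply: le_trans (term j); rewrite normrM normr_prod.
    under eq_bigr do rewrite normrM normfV.
    by rewrite ler_wpM2r ?hcj // prodr_ge0 // => i _; rewrite divr_ge0.
  have h3 := ler_normD (evalR2 c x y - I) I; rewrite subrK in h3.
  rewrite mulrDl -mulrA.
  have h4 := ler_wpM2l E0 hz; rewrite -/(z _) in hI.
  apply: (le_trans h3); apply: lerD => //; exact: le_trans hI h4.
have hcmod j : cmod (evalC2 Q x (a j x)) <= (dk j).2 * X ^+ k j.
  by have [_ _ h] := hdk j; apply: h; exact: (hd1 j x x1).1.
have p1 : `|complex.Re (evalC2 Q x y)| <=
   (E * \prod_(i < M) G i + \sum_(j < M) (dk j).2 * H j * v j) * \prod_(i < M) f i.
  rewrite evalC2E /=; apply: part => // j; apply: le_trans (hcmod j).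
  by have := Re_le_cmod (evalC2 Q x (a j x)); rewrite {1}evalC2E.
have p2 : `|complex.Im (evalC2 Q x y)| <=
   (E * \prod_(i < M) G i + \sum_(j < M) (dk j).2 * H j * v j) * \prod_(i < M) f i.
  rewrite evalC2E /=; apply: part => // j; apply: le_trans (hcmod j).
  by have := Im_le_cmod (evalC2 Q x (a j x)); rewrite {1}evalC2E.
rewrite cmodM cmodV cmod_Pprod ler_pdivrMr //.
apply: (le_trans (cmod_le_ReIm _)); apply: (le_trans (lerD p1 p2)).
rewrite -mulrDl ler_wpM2r ?(ltW W0) //.
have hv : \sum_(j < M) (dk j).2 * H j * v j <= (\sum_(j < M) (dk j).2 * H j) * \sum_(j < M) v j.
  rewrite mulr_sumr; apply: ler_sum => j _; rewrite ler_wpM2r //.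
  rewrite (bigD1 j) //= lerDl sumr_ge0 // => i _; rewrite mulr_ge0 // ltW //.
have sv0 : 0 <= \sum_(j < M) v j by apply: sumr_ge0.
rewrite -/(v _).
set EG := E * _ in EG0 *; set KH := \sum_(j < M) (dk j).2 * H j in KH0 hv *.
set SV := \sum_(j < M) v j in hv sv0 *.
have : 0 <= EG * SV by rewrite mulr_ge0.
nra.
Qed.

End quotient_bound.

(** * Integrability *)

Lemma absz_ceil_bounds (R : realType) (c : R) : 0 <= c ->
  c <= `|Num.ceil c|%N%:R < c + 1.
Proof.
move=> c0; have h0 : 0 <= Num.ceil c by rewrite -(ceil0 R) ceil_le.
have -> : `|Num.ceil c|%N%:R = (Num.ceil c)%:~R :> R by rewrite natr_absz ger0_norm.
by have := ceil_itv c; rewrite intrB ltrBlDr => /andP[-> ->].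
Qed.

Lemma open_contains_box (R : realType) (U : set (R * R)) : open U -> U (0, 0) ->
  exists e : R, 0 < e /\ box e `<=` U.
Proof.
move=> oU U0; have : nbhs ((0, 0) : R * R) U by apply: open_nbhs_nbhs.
move=> -[[A1 A2] [/= /nbhs_ballP[e1 /= e10 A1e] /nbhs_ballP[e2 /= e20 A2e]] AU].
exists (Num.min e1 e2); split; first by rewrite lt_min e10.
move=> [x y] /boxP /=; rewrite !lt_min => -[/andP[x1 _] /andP[_ y2]].
by apply: AU; split => /=; [apply: A1e | apply: A2e]; rewrite /ball /= sub0r normrN.
Qed.

Section integrability.
Variables (R : realType) (M : nat) (L : 'I_M -> nat) (q : 'I_M -> {poly R}).
Variable psi : 'I_M -> nat -> R.
Hypothesis hL : forall j, (0 < L j)%N.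
Hypothesis hq0 : forall j, (q j).[0] = 0.
Hypothesis hpsi : forall j, conv_series1R (psi j).
Hypothesis hord :
  forall i j : 'I_M, i != j -> ord_coef_eq (branch_diff_coef L q psi i j) (Oij L q i j).
Variables (p : R) (Q : nat -> nat -> R[i]).
Hypothesis hp : 1 <= p.
Hypothesis hQ : conv_series2 Q.

Local Notation a := (branch L q psi).
Local Notation O j := (\sum_(i < M) Oij L q i j)%N.
Local Notation f := (fun z : R * R => evalC2 Q z.1 z.2 / Pprod L q z.1 z.2).
Local Notation ce j := (`|Num.ceil ((2 * L j).+1%:R / p)|)%N.

Let p0 : 0 < p. Proof. exact: lt_le_trans hp. Qed.

(** The first inequality forces divergence in the converse; the strict second one is the slack used
    for integrability. *)
Let ce_bounds j : (2 * L j).+1%:R <= (ce j)%:R * p /\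
  (ce j)%:R * p < (2 * L j).+1%:R + p.
Proof.
have c0 : 0 <= (2 * L j).+1%:R / p by rewrite divr_ge0 // ltW.
have /andP[h1 h2] := absz_ceil_bounds c0; split; first by rewrite -ler_pdivrMr.
rewrite -ltr_pdivlMr // mulrDl divff ?gt_eqF //.
Qed.

Lemma Lp_loc_of_ord : (forall j, ord_ge (fun x : R => evalC2 Q x (a j x)) ((O j).+1 - ce j)) ->
  Lp_loc p f.
Proof.
move=> hk.
have [d [A [d0 A0 hA]]] := quotient_pointwise_bound hL hq0 hpsi hord hQ
  (fun j => ord_ge_bound (hk j)).
have h2 : 0 < 1 / 2 :> R by lra.
have [d3 [d30 hd3]] := branches_small hL hq0 hpsi h2.
have [r [K [hc1 hc2]]] := conv_series2_parts hQ.
have r20 : 0 < r / 2 by rewrite divr_gt0 //; exact: hc1.1.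
(* Since [O j] is [2 L_j] plus the off-diagonal sum, this equals [2 L_j + 1 + p - ce_j p], positive
   by the strict ceiling bound. The exponent [dl] is then taken with [dl * (2 L_j + 1) <= mu j] for
   all [j]. *)
pose mu j : R := ((((O j).+1 - ce j)%N)%:R - (\sum_(i < M | i != j) Oij L q i j)%N%:R) * p
  - (2 * L j)%:R * (p - 1) + 1.
have mu0 j : 0 < mu j.
  have [_ cb] := ce_bounds j.
  (* The truncated subtraction is a true one: [p >= 1] gives [ce_j <= 2 L_j + 1], and
     [O j >= 2 L_j]. *)
  have cel : (ce j <= (O j).+1)%N.
    have : (ce j < (2 * L j).+2)%N.
      rewrite -(ltr_nat R) -(ltr_pM2r p0); apply: (lt_le_trans cb).
      rewrite -[X in _ <= X * _]natr1 mulrDl mul1r lerD2r.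
      by rewrite ler_peMr.
    by rewrite Oij_sum; lia.
  rewrite /mu natrB // Oij_sum -addSn natrD; move: cb; rewrite -natr1; nra.
have /fin_radius [dl0 [dl00 hdl0]] : forall j : 'I_M, exists d : R, 0 < d /\
    forall x : R, `|x| <= d -> x * (2 * L j).+1%:R <= mu j.
  move=> j; exists (mu j / (2 * L j).+1%:R); split; first by rewrite divr_gt0.
  by move=> x; rewrite ler_pdivlMr //; apply: le_trans; rewrite ler_wpM2r // ler_norm.
pose dl := Num.min dl0 (1 / 2).
have dlgt0 : 0 < dl by rewrite lt_min dl00 h2.
have dl01 : 0 < dl < 1.
  by rewrite dlgt0 /=; have : dl <= 1 / 2 by [rewrite ge_min lexx orbT]; lra.
pose d' := Num.min (Num.min d d3) (Num.min (1 / 2) (r / 2)).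
have d'0 : 0 < d' by rewrite !lt_min d0 d30 h2 r20.
have [d'd d'd3 d'h d'r] : [/\ d' <= d, d' <= d3, d' <= 1 / 2 & d' <= r / 2].
  by rewrite /d' !ge_min !lexx ?orbT; split.
have mf : cmeasurable_fun (box d') f.
  apply: cmeasurable_funM; first exact: (cmeasurable_evalC2 hc1 hc2).
  by apply: cmeasurable_funV; exact: cmeasurable_Pprod.
exists (box d'); split; first exact: open_box.
split; first by apply/boxP; rewrite /= normr0.
split; first exact: mf.1.
split; first exact: mf.2.
apply: (@integral_box_lty _ d' dl (A `^ p * M.+1%:R `^ p) M a) => //.
- by rewrite mulr_gt0 // powR_gt0.
- exact: measurable_cmod_powR.
- by move=> z; exact: powR_ge0.
- by move=> j x /ltW xd; apply: hd3; exact: le_trans d'd3.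
move=> x y xd yd x0 ya /=.
have X0 : 0 < `|x| by rewrite normr_gt0.
have X1 : `|x| <= 1 by lra.
have h := hA x y (le_trans (ltW xd) d'd) (le_trans (ltW yd) d'd) x0.
set v := fun j : 'I_M => `|x| ^+ ((O j).+1 - ce j) /
  (`|x| ^+ (\sum_(i < M | i != j) Oij L q i j) * (`|y - a j x| + `|x| ^+ (2 * L j))) in h *.
have v0 j : 0 <= v j.
  by rewrite divr_ge0 ?mulr_ge0 ?addr_ge0 ?exprn_ge0.
apply: (@le_trans _ _ ((A * (1 + \sum_(j < M) v j)) `^ p)).
  apply: ge0_ler_powR => //; rewrite ?nnegrE ?cmod_ge0 ?(ltW p0) //.
  by rewrite mulr_ge0 ?(ltW A0) // addr_ge0 // sumr_ge0.
rewrite powRM ?(ltW A0) //; last by rewrite addr_ge0 // sumr_ge0.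
rewrite -!mulrA ler_wpM2l ?powR_ge0 //.
apply: (le_trans (powR_1Dsum_le (ltW p0) v0)).
rewrite ler_wpM2l ?powR_ge0 // mulrDr mulr1 mulr_sumr.
apply: lerD.
  rewrite -{1}(powRr0 `|x|); apply: ger_powR; rewrite ?X0 //.
  by move: dl01 => /andP[? ?]; lra.
apply: ler_sum => j _; apply: branch_term_powR_le => //; rewrite ?X0 //.
  by rewrite normr_gt0 subr_eq0.
apply: hdl0; rewrite gtr0_norm //.
by rewrite ge_min lexx.
Qed.

(** A single real component [c] of [Q] is enough, since a lower bound on it is one on [|Q|]. A
    nonzero coefficient of index [n] gives an exact order [k0 <= n], and an order below the
    threshold makes the integral infinite. *)
Lemma ord_of_Lp_loc_part (c : nat -> nat -> R) (r K : R) (g : nat -> R) (j : 'I_M) (n : nat) :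
  coef2_le c r K -> (forall x y, `|evalR2 c x y| <= cmod (evalC2 Q x y)) ->
  is_ps (fun x => evalR2 c x (a j x)) g -> Lp_loc p f ->
  (n < (O j).+1 - ce j)%N -> g n = 0.
Proof.
move=> hc hcQ hg [U [oU [U0 [mU1 [mU2 hint]]]]] nk; apply/eqP/negPn/negP => gn.
have ex : exists m, g m != 0 by exists n.
have [k0 [gk0 k0n]] : exists k0, ord_coef_eq g k0 /\ (k0 <= n)%N.
  case: (ex_minnP ex) => k0 gk0 hmin; exists k0; split; last exact: hmin.
  split => // m mk0; apply/eqP/negPn/negP => /hmin; rewrite leqNgt mk0 //.
have r0 := hc.1.
have [r' [K' [hc1 hc2]]] := conv_series2_parts hQ.
have r'0 : 0 < r' / 2 by rewrite divr_gt0 //; exact: hc1.1.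
have [e [e0 eU]] := open_contains_box oU U0.
have [d [d0 de dr]] : exists d : R, [/\ 0 < d, d <= e & d <= r' / 2].
  by exists (Num.min e (r' / 2)); rewrite lt_min e0 !ge_min !lexx orbT; split.
have mf : cmeasurable_fun (box d) f.
  apply: cmeasurable_funM; first exact: (cmeasurable_evalC2 hc1 hc2).
  by apply: cmeasurable_funV; exact: cmeasurable_Pprod.
have [d1 [lo [hi [d10 lo0 _ hlo]]]] := is_ps_ord_coef hg gk0.
have r40 : 0 < r / 4 by rewrite divr_gt0.
have [d2 [d20 hd2]] := branches_small hL hq0 hpsi r40.
have d40 : 0 < d / 4 by rewrite divr_gt0.
have [d3 [d30 hd3]] := branches_small hL hq0 hpsi d40.
have l0 : (0 < 2 * L j)%N by rewrite muln_gt0 hL.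
have d120 : 0 < Num.min d1 d2 by rewrite lt_min d10.
have ha12 x : 0 < x <= Num.min d1 d2 -> `|a j x| <= r / 4.
  by rewrite le_min => /and3P[x0 _ x2]; apply: hd2; rewrite gtr0_norm.
have hg12 x : 0 < x <= Num.min d1 d2 -> lo * x ^+ k0 <= `|evalR2 c x (a j x)|.
  rewrite le_min => /and3P[x0 x1 _]; have := hlo x; rewrite gtr0_norm // => /(_ x1).
  by case/andP.
have [d4 [eta [c1 [d40' eta0 c10 hlarge]]]] :=
  evalR2_large_on_interval (erefl k0.+1) hc l0 d120 lo0 ha12 hg12.
have D0 : 0 <= k0.+1%:R :> R by [].
have [d5 [Cw [d50 Cw0 hW]]] := Pprod_upper hpsi hord j D0.
have D0' : 0 < k0.+1%:R :> R by [].
(* [d3] keeps the branch within [d / 4], and the last entry keeps the offset [s * x^(2 L_j)] within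
   [d / 4], so the whole interval of large values stays in the box. *)
pose d' := Num.min (Num.min (Num.min d d3) (Num.min d4 d5)) (Num.min 1 (d / 4 / k0.+1%:R)).
have d'0 : 0 < d' by rewrite !lt_min d0 d30 d40' d50 ltr01 divr_gt0.
pose kap := (c1 / Cw) `^ p * eta.
have kap0 : 0 < kap by rewrite mulr_gt0 // powR_gt0 // divr_gt0.
have : (\int[(@lebesgue_measure R) \x (@lebesgue_measure R)]_(z in box d)
        ((cmod (f z)) `^ p)%:E < +oo)%E.
  apply: le_lt_trans hint; apply: ge0_subset_integral.
  - exact: measurable_box.
  - exact: open_measurable_prod.
  - by apply/measurable_EFinP; exact: (measurable_cmod_powR p (conj mU1 mU2)).
  - by move=> z _; rewrite lee_fin powR_ge0.
  - apply: subset_trans eU => z /boxP[z1 z2]; apply/boxP; split.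
      exact: lt_le_trans z1 de.
    exact: lt_le_trans z2 de.
rewrite (@integral_box_infty _ d d' kap) //.
- by rewrite !ge_min lexx.
- exact: measurable_cmod_powR.
- by move=> z; exact: powR_ge0.
move=> x /andP[x0]; rewrite !lt_min => /andP[/andP[/andP[xd x3] /andP[x4 x5]] /andP[x1 xD]].
have [s0 hs0] : exists s0 : R, forall s, s0 <= s <= s0 + eta ->
      0 <= s <= k0.+1%:R /\ c1 * x ^+ k0 <= `|evalR2 c x (a j x + s * x ^+ (2 * L j))|.
  by apply: hlarge; rewrite x0 ltW.
have xl0 : 0 < x ^+ (2 * L j) by rewrite exprn_gt0.
have xn0 : x != 0 by rewrite gt_eqF.
have B0 : 0 <= c1 * x ^+ k0 / (Cw * x ^+ O j).
  by rewrite divr_ge0 ?mulr_ge0 ?exprn_ge0 ?ltW.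
exists (a j x + s0 * x ^+ (2 * L j)), (eta * x ^+ (2 * L j)),
  ((c1 * x ^+ k0 / (Cw * x ^+ O j)) `^ p); split.
- by rewrite mulr_gt0.
- exact: powR_ge0.
- have -> : c1 * x ^+ k0 / (Cw * x ^+ O j) = c1 / Cw * x `^ (k0%:R - (O j)%:R).
    rewrite powRB ?xn0 ?implybT // !powR_mulrn ?(ltW x0) //.
    by field; rewrite expf_neq0 // gt_eqF.
  rewrite powRM ?powR_ge0 //; last by rewrite divr_ge0 // ltW.
  rewrite -(powR_mulrn (2 * L j) (ltW x0)) -powRrM.
  rewrite (_ : _ * _ * (eta * _) = kap * (x `^ ((k0%:R - (O j)%:R) * p) * x `^ (2 * L j)%:R)); last first.
    by rewrite /kap; ring.
  rewrite ler_wpM2l ?(ltW kap0) // -powRD ?xn0 ?implybT // -powR_inv1 ?(ltW x0) //.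
  (* The exponent [(k0 - O) p + 2 L_j] is at most [-ce_j p + 2 L_j <= -1], because [k0 + ce_j <= O]
     and [2 L_j + 1 <= ce_j p]. *)
  apply: ger_powR; first by rewrite x0 ltW.
  have [cb _] := ce_bounds j.
  have hk : (k0 + ce j <= O j)%N.
    move: nk; rewrite ltn_subRL ltnS => h; apply: leq_trans h.
    by rewrite addnC leq_add2l.
  have : k0%:R + (ce j)%:R <= (O j)%:R :> R by rewrite -natrD ler_nat.
  move: cb; rewrite -natr1; have := p0; nra.
move=> y hy; pose s := (y - a j x) / x ^+ (2 * L j).
have yE : y = a j x + s * x ^+ (2 * L j) by rewrite /s divfK ?gt_eqF // addrC subrK.
have [sD hQs] : 0 <= s <= k0.+1%:R /\ c1 * x ^+ k0 <= `|evalR2 c x y|.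
  rewrite yE; apply: hs0; rewrite /s ler_pdivlMr // ler_pdivrMr //.
  by move: hy => /andP[h1 h2]; apply/andP; split; lra.
move: sD => /andP[sge0 sD].
have hy2 : `|y - a j x| <= k0.+1%:R * x ^+ (2 * L j).
  rewrite yE addrAC subrr add0r (ger0_norm (mulr_ge0 sge0 (ltW xl0))).
  by rewrite ler_wpM2r // ltW.
split.
  have ax : `|a j x| <= d / 4 by apply: hd3; rewrite gtr0_norm // ltW.
  have xl : x ^+ (2 * L j) <= x.
    by rewrite -[X in _ <= X]expr1 ler_wiXn2l ?(ltW x0) ?(ltW x1).
  have hx : k0.+1%:R * x <= d / 4 by rewrite mulrC -ler_pdivlMr // ltW.
  have h3 : k0.+1%:R * x ^+ (2 * L j) <= k0.+1%:R * x by rewrite ler_wpM2l.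
  have h4 := ler_normD (y - a j x) (a j x); rewrite subrK in h4.
  by lra.
apply: ge0_ler_powR; rewrite ?nnegrE ?cmod_ge0 ?(ltW p0) //.
have hx5 : 0 < x <= d5 by rewrite x0 ltW.
have /andP[W0 WC] := hW x y hx5 hy2.
rewrite cmodM cmodV /=; apply: ler_pM.
- by rewrite mulr_ge0 ?exprn_ge0 // ltW.
- by rewrite invr_ge0 mulr_ge0 ?exprn_ge0 // ltW.
- exact: le_trans hQs (hcQ x y).
- rewrite lef_pV2 ?posrE //; last by rewrite mulr_gt0 // exprn_gt0.
Qed.

Lemma ord_of_Lp_loc j : Lp_loc p f ->
  ord_ge (fun x : R => evalC2 Q x (a j x)) ((O j).+1 - ce j).
Proof.
move=> hLp; have [r [K [hc1 hc2]]] := conv_series2_parts hQ.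
have [g1 hg1] := is_ps_comp hc1 (branch_is_ps L q hpsi j) (branch_coef0 psi hL hq0 j).
have [g2 hg2] := is_ps_comp hc2 (branch_is_ps L q hpsi j) (branch_coef0 psi hL hq0 j).
have -> : (fun x : R => evalC2 Q x (a j x)) =
  (fun x => Complex (evalR2 (fun m n => complex.Re (Q m n)) x (a j x))
                    (evalR2 (fun m n => complex.Im (Q m n)) x (a j x))).
  by apply/funext => x; rewrite evalC2E.
apply: (ord_ge_parts hg1 hg2) => n.
  apply: (ord_of_Lp_loc_part hc1 _ hg1 hLp) => x y.
  by have := Re_le_cmod (evalC2 Q x y); rewrite {1}evalC2E.
apply: (ord_of_Lp_loc_part hc2 _ hg2 hLp) => x y.
by have := Im_le_cmod (evalC2 Q x y); rewrite {1}evalC2E.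
Qed.

End integrability.

Unset Implicit Arguments.

Theorem theorem5p2 (R : realType) (M : nat) (L : 'I_M -> nat)
  (q : 'I_M -> {poly R})
  (hL : forall j, (0 < L j)%N)
  (hdeg : forall j, (size (q j) <= 2 * L j)%N)
  (hq0 : forall j, (q j).[0] = 0)
  (t : R) (u : nat -> nat -> R[i]) (psi : 'I_M -> nat -> R)
  (hproper : proper_factorization L q t u psi)
  (p : R) (hp : 1 <= p)
  (Q : nat -> nat -> R[i]) (hQ : conv_series2 Q) :
  Lp_loc p (fun z : R * R => evalC2 Q z.1 z.2 / Pprod L q z.1 z.2)
  <->
  (forall j : 'I_M,
     ord_ge (fun x : R => evalC2 Q x (branch L q psi j x))
       ((\sum_(i < M) Oij L q i j).+1
        - `|Num.ceil ((2 * L j).+1%:R / p)|)%N).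
Proof.
have [_ [hpsi [_ hord]]] := hproper.
split; first by move=> hLp j; exact: ord_of_Lp_loc hLp.
exact: Lp_loc_of_ord.
Qed.
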